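(* Let $n$ be a natural number not divisible by $3$, let $u$ be the congruence class of $\|n\|_{\mathrm{st}}$ modulo $3$, and let $\alpha$ be the ordinal with $\delta_{\mathrm{st}}(n)=\mathscr{D}^u_{\mathrm{st}}[\alpha]$. Then the set $\{\mathscr{D}^{u+1}_{\mathrm{st}}[\omega\alpha+k]:k\in\mathbb{Z}_{\ge0}\}$, which equals $\mathscr{D}^{u+1}_{\mathrm{st}}\cap[\mathscr{D}^{u+1}_{\mathrm{st}}[\omega\alpha],\delta_{\mathrm{st}}(n)+1)$, has finite symmetric difference with the set \[\{\delta_{\mathrm{st}}(b(a3^k+1)):k\ge0,\ a,b\in\mathbb{N},\ ab=n,\ \|n\|_{\mathrm{st}}=\|a\|_{\mathrm{st}}+\|b\|_{\mathrm{st}}\}.\] Similarly, if $\delta_{\mathrm{st}}(n)=\mathscr{D}_{\mathrm{st}}[\alpha]$, then the set $\{\mathscr{D}_{\mathrm{st}}[\omega\alpha+k]:k\in\mathbb{Z}_{\ge0}\}$, which equals $\mathscr{D}_{\mathrm{st}}\cap[\mathscr{D}_{\mathrm{st}}[\omega\alpha],\delta_{\mathrm{st}}(n)+1)$, has finite symmetric difference with the same set $\{\delta_{\mathrm{st}}(b(a3^k+1)):k\ge0,\ ab=n,\ \|n\|_{\mathrm{st}}=\|a\|_{\mathrm{st}}+\|b\|_{\mathrm{st}}\}$.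
   Context: $\|n\|$ denotes the integer complexity of $n\in\mathbb{N}$ (least number of $1$'s needed to write $n$ using $1$, $+$, $\cdot$ and parentheses), and $\delta(n)=\|n\|-3\log_3 n$. $n$ is stable if $\|3^kn\|=3k+\|n\|$ for all $k\ge0$; for every $n$ some $3^kn$ is stable, and $\|n\|_{\mathrm{st}}=\|3^kn\|-3k$, $\delta_{\mathrm{st}}(n)=\delta(3^kn)$ for any such $k$. $\mathscr{D}_{\mathrm{st}}=\{\delta(n):n\text{ stable}\}$ and, for a congruence class $u$ mod $3$, $\mathscr{D}^u_{\mathrm{st}}=\{\delta(n):n>1\text{ stable},\ \|n\|\equiv u\pmod3\}$; these are well-ordered subsets of $\mathbb{R}$. For a well-ordered set $S$ and ordinal $\gamma$, $S[\gamma]$ denotes the element of $S$ whose set of predecessors in $S$ has order type $\gamma$. *)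

(* Defs.v *)
From Stdlib Require Relation_Operators Wellfounded.
From mathcomp Require Import all_boot all_order all_algebra.
From mathcomp Require Import all_classical all_reals all_analysis.

Set Implicit Arguments.
Unset Strict Implicit.
Unset Printing Implicit Defensive.

Import Order.TTheory GRing.Theory Num.Theory.
Local Open Scope classical_set_scope.
Local Open Scope ring_scope.

Inductive expr := One | Add of expr & expr | Mul of expr & expr.

Fixpoint value (e : expr) : nat :=
  match e with
  | One => 1%N
  | Add e1 e2 => (value e1 + value e2)%N
  | Mul e1 e2 => (value e1 * value e2)%N
  end.

Fixpoint ones (e : expr) : nat :=
  match e with
  | One => 1%N
  | Add e1 e2 | Mul e1 e2 => (ones e1 + ones e2)%N
  end.

(* No expression has value 0, and [complexity 0] is the default 0. *)
Definition complexity (n : nat) : nat :=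
  xget 0%N [set c | (exists2 e, value e = n & ones e = c) /\
                    forall e, value e = n -> (c <= ones e)%N].

Definition defect (R : realType) (n : nat) : R :=
  (complexity n)%:R - 3 * (ln n%:R / ln 3).

Definition stable (n : nat) : Prop :=
  forall k, complexity (3 ^ k * n)%N = (3 * k + complexity n)%N.

Definition stable_exponent (n : nat) : nat :=
  xget 0%N [set k | stable (3 ^ k * n)%N].

(* The subtraction does not truncate: a positive m satisfies
   complexity m >= 3 log_3 m, hence complexity (3 ^ k * n) >= 3 * k. *)
Definition st_complexity (n : nat) : nat :=
  (complexity (3 ^ stable_exponent n * n)%N - 3 * stable_exponent n)%N.

Definition st_defect (R : realType) (n : nat) : R :=
  defect R (3 ^ stable_exponent n * n)%N.

Definition Dst (R : realType) : set R :=
  [set defect R n | n in [set n | (0 < n)%N /\ stable n]].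

Definition Dst_class (R : realType) (u : 'Z_3) : set R :=
  [set defect R n | n in
    [set n | [/\ (1 < n)%N, stable n & (complexity n)%:R = u :> 'Z_3]]].

Arguments Dst R : clear implicits.
Arguments Dst_class R u : clear implicits.

(* Ordinals are represented by well-ordered types. They only matter up to
   order isomorphism, through [has_order_type]. *)
Record ordinal_number := OrdinalNumber {
  ocarrier :> Type;
  olt : ocarrier -> ocarrier -> Prop;
  olt_trans : forall x y z, olt x y -> olt y z -> olt x z;
  olt_total : forall x y, olt x y \/ x = y \/ olt y x;
  olt_wf : well_founded olt
}.

Section OrdinalArithmetic.
Import Relation_Operators.

Fact nat_olt_trans (x y z : nat) : (x < y)%N -> (y < z)%N -> (x < z)%N.
Proof. exact: ltn_trans. Qed.

Fact nat_olt_total (x y : nat) : (x < y)%N \/ x = y \/ (y < x)%N.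
Proof. by case: (ltngtP x y); auto. Qed.

Fact nat_olt_wf : well_founded (fun x y : nat => (x < y)%N).
Proof.
move=> x; elim/ltn_ind: x => x IH; constructor=> y; exact: IH.
Qed.

Definition omega : ordinal_number :=
  OrdinalNumber nat_olt_trans nat_olt_total nat_olt_wf.

Fact fin_olt_trans k (x y z : 'I_k) : (x < y)%N -> (y < z)%N -> (x < z)%N.
Proof. exact: ltn_trans. Qed.

Fact fin_olt_total k (x y : 'I_k) : (x < y)%N \/ x = y \/ (y < x)%N.
Proof. by case: (ltngtP x y) => [||/val_inj]; auto. Qed.

Fact fin_olt_wf k : well_founded (fun x y : 'I_k => (x < y)%N).
Proof. exact: (Inverse_Image.wf_inverse_image _ _ _ (@nat_of_ord k) nat_olt_wf). Qed.

Definition ofin (k : nat) : ordinal_number :=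
  OrdinalNumber (@fin_olt_trans k) (@fin_olt_total k) (@fin_olt_wf k).

Fact oadd_trans (a b : ordinal_number) (x y z : a + b) :
  le_AsB _ _ (@olt a) (@olt b) x y -> le_AsB _ _ (@olt a) (@olt b) y z ->
  le_AsB _ _ (@olt a) (@olt b) x z.
Proof.
by case: x y z => [x|x] [y|y] [z|z] xy yz; inversion xy; inversion yz; subst;
  constructor; apply: olt_trans; eassumption.
Qed.

Fact oadd_total (a b : ordinal_number) (x y : a + b) :
  le_AsB _ _ (@olt a) (@olt b) x y \/ x = y \/
  le_AsB _ _ (@olt a) (@olt b) y x.
Proof.
case: x y => [x|x] [y|y].
- by case: (olt_total x y) => [|[->|]]; auto using le_aa.
- by left; constructor.
- by right; right; constructor.
- by case: (olt_total x y) => [|[->|]]; auto using le_bb.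
Qed.

Definition oadd (a b : ordinal_number) : ordinal_number :=
  OrdinalNumber (@oadd_trans a b) (@oadd_total a b)
    (Disjoint_Union.wf_disjoint_sum _ _ _ _ (@olt_wf a) (@olt_wf b)).

Fact omul_trans (a b : ordinal_number) (x y z : b * a) :
  slexprod _ _ (@olt b) (@olt a) x y -> slexprod _ _ (@olt b) (@olt a) y z ->
  slexprod _ _ (@olt b) (@olt a) x z.
Proof.
case: x y z => [x1 x2] [y1 y2] [z1 z2] xy yz.
inversion xy; inversion yz; subst.
- by apply: left_slex; apply: olt_trans; eassumption.
- exact: left_slex.
- exact: left_slex.
- by apply: right_slex; apply: olt_trans; eassumption.
Qed.

Fact omul_total (a b : ordinal_number) (x y : b * a) :
  slexprod _ _ (@olt b) (@olt a) x y \/ x = y \/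
  slexprod _ _ (@olt b) (@olt a) y x.
Proof.
case: x y => [x1 x2] [y1 y2].
case: (olt_total x1 y1) => [|[->|]]; auto using left_slex.
by case: (olt_total x2 y2) => [|[->|]]; auto using right_slex.
Qed.

(* The usual convention: [omul a b] is [b] copies of [a]. *)
Definition omul (a b : ordinal_number) : ordinal_number :=
  OrdinalNumber (@omul_trans a b) (@omul_total a b)
    (Lexicographic_Product.wf_slexprod _ _ _ _ (@olt_wf b) (@olt_wf a)).

End OrdinalArithmetic.

Definition has_order_type (R : realType) (S : set R) (g : ordinal_number) : Prop :=
  exists2 f : g -> R, set_bij setT S f & forall x y, olt x y <-> f x < f y.

(* [elt_at S g x] reads x = S[g]. It is a relation, as S[g] exists only
   for g below the order type of S. *)
Definition elt_at (R : realType) (S : set R) (g : ordinal_number) (x : R) : Prop :=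
  S x /\ has_order_type [set y | S y /\ y < x] g.

Definition block (R : realType) (S : set R) (g : ordinal_number) : set R :=
  [set x | exists k : nat, elt_at S (oadd (omul omega g) (ofin k)) x].

Definition factor_defects (R : realType) (n : nat) : set R :=
  [set x | exists k a b : nat,
    [/\ (a * b)%N = n,
        st_complexity n = (st_complexity a + st_complexity b)%N
      & x = st_defect R (b * (a * 3 ^ k + 1))%N]].

Arguments factor_defects R n : clear implicits.

(* Main.v *)
Require Import Defs.
From mathcomp Require Import all_boot all_order all_algebra.
From mathcomp Require Import all_classical all_reals all_analysis.
From mathcomp Require Import zify ring lra.

(** Below any bound on the defect, an optimal expression splits off a definite
    amount of defect at each step that is not a multiplication by 3, so numbers
    of bounded defect arise from powers of 3 by boundedly many products and
    additions of bounded constants. Along a free ultrafilter, a sequence N of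
    such numbers is therefore asymptotic from above to c 3^t for a fixed c, and
    it costs at least ||c||_st + 3 t plus the constants added on the way. Hence
    the limit points of the stable defects are all of the form
    delta_st(c) + j with j >= 1, approached from below, and when j = 1 a single 1
    was added, so that N is 3^s b (a 3^k + 1) with ab = c and
    ||c||_st = ||a||_st + ||b||_st. Conversely, if b (a 3^k + 1) were cheaper than
    its naive cost infinitely often, its values would be asymptotic to ab 3^k
    at a cost at most ||ab||_st + 3 k, contradicting the lower bound
    ||ab||_st + 1 + 3 k.

    No limit point is itself a stable defect, since 3 log_3 of a ratio is an
    integer only when the ratio is a power of 3. So each x in D^u cuts out the
    stretch of elements of D^(u+1) lying in [sup of the x' + 1, x + 1), with x'
    ranging over the elements of D^u below x; it has order type omega because
    its only limit point is x + 1. These stretches, concatenated over the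
    elements of D^u below x, give omega * alpha. *)

Set Implicit Arguments.
Unset Strict Implicit.
Unset Printing Implicit Defensive.

Import Order.TTheory GRing.Theory Num.Theory.
Local Open Scope classical_set_scope.
Local Open Scope ring_scope.

(** * Integer complexity and its stable version *)

Section Complexity.
Local Open Scope nat_scope.

Lemma value_gt0 e : 0 < value e.
Proof. by elim: e => //= e1 H1 e2 H2; rewrite ?addn_gt0 ?muln_gt0 H1 H2. Qed.

Lemma ones_gt0 e : 0 < ones e.
Proof. by elim: e => //= e1 H1 e2 H2; rewrite addn_gt0 H1. Qed.

Lemma complexity_spec n : 0 < n ->
  (exists2 e, value e = n & ones e = complexity n) /\
  forall e, value e = n -> complexity n <= ones e.
Proof.
move=> n0.
have ex : exists c, `[< exists2 e, value e = n & ones e = c >].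
  suff [e ev] : exists e, value e = n by exists (ones e); apply/asboolP; exists e.
  elim: n n0 => // -[_ _|n IH _]; first by exists One.
  by have [e ev] := IH isT; exists (Add One e); rewrite /= ev.
apply: (@xgetPex _ 0 [set c | (exists2 e, value e = n & ones e = c) /\
  forall e, value e = n -> c <= ones e]).
exists (ex_minn ex); case: ex_minnP => c /asboolP hc cmin; split=> // e ev.
by apply: cmin; apply/asboolP; exists e.
Qed.

Lemma complexity_le e : complexity (value e) <= ones e.
Proof. by have [_] := complexity_spec (value_gt0 e); apply. Qed.

Lemma complexity_gt0 n : 0 < n -> 0 < complexity n.
Proof. by move=> /complexity_spec [[e _ <-] _]; exact: ones_gt0. Qed.

Lemma complexity1 : complexity 1 = 1.
Proof.
by apply/eqP; rewrite eqn_leq complexity_gt0 // (complexity_le One).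
Qed.

Lemma complexityD m n : 0 < m -> 0 < n ->
  complexity (m + n) <= complexity m + complexity n.
Proof.
move=> /complexity_spec [[e <- <-] _] /complexity_spec [[f <- <-] _].
exact: (complexity_le (Add e f)).
Qed.

Lemma complexityM m n : 0 < m -> 0 < n ->
  complexity (m * n) <= complexity m + complexity n.
Proof.
move=> /complexity_spec [[e <- <-] _] /complexity_spec [[f <- <-] _].
exact: (complexity_le (Mul e f)).
Qed.

(** The delicate case is a sum. Two summands of at least 2 have a sum at most their product; for
    [y = 1] and [3 <= x] the cube grows by at most (4/3)^3 < 3; [x = 1] and [x = 2] are checked
    directly. *)
Lemma value_ones e : value e ^ 3 <= 3 ^ ones e.
Proof.
have addb (x y p q : nat) : 0 < x -> 0 < y -> 0 < p -> 0 < q -> x ^ 3 <= 3 ^ p -> y ^ 3 <= 3 ^ q ->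
    (x + y) ^ 3 <= 3 ^ (p + q).
  wlog yx : x y p q / y <= x.
    move=> wl; have [|/ltnW xy] := leqP y x; first exact: wl.
    by move=> *; rewrite addnC [p + q]addnC; apply: wl.
  move=> x0 y0 p1 q1 hx hy.
  have [y2|y1] := leqP 2 y.
    apply: (@leq_trans ((x * y) ^ 3)); first by rewrite leq_exp2r//; nia.
    by rewrite expnMn expnD leq_mul.
  have -> : y = 1 by lia.
  have [x3|] := leqP 3 x.
    apply: (@leq_trans (3 ^ (p + 1))); last by rewrite leq_exp2l //; lia.
    apply: (@leq_trans (x ^ 3 * 3)); last by rewrite expnD leq_mul.
    rewrite !expnS !expn0; nia.
  move: x0 hx; case: x yx => [|[|[|]]] // _ _ hx _.
    by apply: (@leq_trans (3 ^ 2)) => //; rewrite leq_exp2l //; lia.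
  suff p2 : 1 < p by apply: (@leq_trans (3 ^ 3)) => //; rewrite leq_exp2l //; lia.
  by case: p hx {p1} => [|[|]].
elim: e => //= e1 H1 e2 H2; first by apply: addb => //; rewrite ?value_gt0 ?ones_gt0.
by rewrite expnMn expnD leq_mul.
Qed.

Lemma complexity_ge n : 0 < n -> n ^ 3 <= 3 ^ complexity n.
Proof. by move=> /complexity_spec [[e <- <-] _]; exact: value_ones. Qed.

Lemma complexity_ge_exp3 k n : 0 < n -> 3 * k <= complexity (3 ^ k * n).
Proof.
move=> n0; have p0 : 0 < 3 ^ k * n by rewrite muln_gt0 expn_gt0.
rewrite -(@leq_exp2l 3) //; apply: leq_trans (complexity_ge p0).
by rewrite expnMn -expnM mulnC leq_pmulr // expn_gt0 n0.
Qed.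

Lemma complexity_decomp n : 1 < n ->
  exists a b, [/\ 0 < a < n, 0 < b < n, complexity n = complexity a + complexity b
    & n = a + b \/ n = a * b].
Proof.
move=> n1; have [[e]] := complexity_spec (ltnW n1).
case: e => [|e f|e f] /=; first by move=> h; rewrite -h in n1.
  move=> ev ec _; exists (value e), (value f).
  have := value_gt0 e; have := value_gt0 f.
  split; [lia|lia| |by left].
  have := complexity_le e; have := complexity_le f.
  by have := complexityD (value_gt0 e) (value_gt0 f); rewrite ev; lia.
move=> ev ec _; exists (value e), (value f).
have e0 := value_gt0 e; have f0 := value_gt0 f.
have ce := complexity_le e; have cf := complexity_le f.
have cM := complexityM e0 f0; rewrite ev in cM.
have ce0 := complexity_gt0 e0; have cf0 := complexity_gt0 f0.
(* A factor 1 would make the other factor an expression for [n] with fewer ones than the optimal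
   one. *)
have e1 : value e <> 1 by move=> h; rewrite h mul1n in ev; rewrite ev in cf; lia.
have f1 : value f <> 1 by move=> h; rewrite h muln1 in ev; rewrite ev in ce; lia.
split; [nia|nia|lia|by right].
Qed.

Lemma complexity_exp3 k : 0 < k -> complexity (3 ^ k) = 3 * k.
Proof.
move=> k0; apply/eqP; rewrite eqn_leq -{2}(muln1 (3 ^ k)) complexity_ge_exp3 // andbT.
case: k k0 => // k _; elim: k => [|k IH].
  exact: (complexity_le (Add One (Add One One))).
rewrite expnS; apply: leq_trans (complexityM _ _) _ => //; first by rewrite expn_gt0.
have : complexity 3 <= 3 := complexity_le (Add One (Add One One)).
lia.
Qed.

Lemma complexity_mul3 k n : 0 < n -> complexity (3 ^ k * n) <= 3 * k + complexity n.
Proof.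
move=> n0; case: k => [|k]; first by rewrite mul1n.
by rewrite -(@complexity_exp3 k.+1) // complexityM // expn_gt0.
Qed.

(** Multiplying by 3 costs at most 3, so [complexity (3 ^ k * n) - 3 * k] does not increase with
    [k]; where it attains its minimum, [3 ^ k * n] is stable. *)
Lemma stable_ex n : 0 < n -> exists k, stable (3 ^ k * n).
Proof.
move=> n0.
have [m mP] : exists m, (exists k, complexity (3 ^ k * n) - 3 * k = m) /\
    forall k, m <= complexity (3 ^ k * n) - 3 * k.
  have ex : exists m, `[< exists k, complexity (3 ^ k * n) - 3 * k = m >].
    by exists (complexity (3 ^ 0 * n) - 3 * 0); apply/asboolP; exists 0.
  exists (ex_minn ex); case: ex_minnP => m /asboolP hm mmin; split=> // k.
  by apply: mmin; apply/asboolP; exists k.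
case: mP => -[k km] mmin; exists k => j.
have kn0 : 0 < 3 ^ k * n by rewrite muln_gt0 expn_gt0.
have := complexity_mul3 j kn0.
have := mmin (j + k); rewrite expnD -mulnA.
have := complexity_ge_exp3 (j + k) n0; rewrite expnD -mulnA.
by have := complexity_ge_exp3 k n0; lia.
Qed.

Lemma stable_exponentP n : 0 < n -> stable (3 ^ stable_exponent n * n).
Proof.
by move=> /stable_ex ex; apply: (@xgetPex _ 0 [set k | stable (3 ^ k * n)]).
Qed.

Lemma complexity_st_exponent n : 0 < n ->
  complexity (3 ^ stable_exponent n * n) =
  3 * stable_exponent n + st_complexity n.
Proof. by move=> n0; rewrite /st_complexity subnKC // complexity_ge_exp3. Qed.

Lemma complexity_st k n : 0 < n -> stable_exponent n <= k ->
  complexity (3 ^ k * n) = 3 * k + st_complexity n.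
Proof.
move=> n0 hk; rewrite -(subnK hk) expnD -mulnA (stable_exponentP n0).
by rewrite complexity_st_exponent //; lia.
Qed.

Lemma st_complexity_le k n : 0 < n -> 3 * k + st_complexity n <= complexity (3 ^ k * n).
Proof.
move=> n0; have kn0 : 0 < 3 ^ k * n by rewrite muln_gt0 expn_gt0.
have := complexity_mul3 (stable_exponent n) kn0.
by rewrite mulnA -expnD complexity_st //; lia.
Qed.

Lemma st_complexity_unique k m n : 0 < n ->
  (forall j, k <= j -> complexity (3 ^ j * n) = 3 * j + m) -> st_complexity n = m.
Proof.
move=> n0 h; have := h (maxn k (stable_exponent n)) (leq_maxl _ _).
by rewrite complexity_st ?leq_maxr //; lia.
Qed.

Lemma st_complexity_mul3 k n : 0 < n -> st_complexity (3 ^ k * n) = 3 * k + st_complexity n.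
Proof.
move=> n0; apply: (@st_complexity_unique (stable_exponent n)).
  by rewrite muln_gt0 expn_gt0.
by move=> j hj; rewrite mulnA -expnD complexity_st //; lia.
Qed.

Lemma stable_complexity n : 0 < n -> stable n -> complexity n = st_complexity n.
Proof.
by move=> n0 sn; apply/esym/(@st_complexity_unique 0) => // j _; exact: sn.
Qed.

Lemma st_complexity1 : st_complexity 1 = 0.
Proof.
apply: (@st_complexity_unique 1) => // j j0; rewrite muln1 complexity_exp3 //; lia.
Qed.

(** 3 costs 3, not 3 + 1. This reconciles the range [0 < n] in [Dst] with [1 < n] in [Dst_class]. *)
Lemma not_stable1 : ~ stable 1.
Proof. by move=> /(_ 1); rewrite muln1 complexity1 complexity_exp3. Qed.

Lemma st_complexityM m n : 0 < m -> 0 < n ->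
  st_complexity (m * n) <= st_complexity m + st_complexity n.
Proof.
move=> m0 n0; set k := stable_exponent m; set l := stable_exponent n.
have mn0 : 0 < m * n by rewrite muln_gt0 m0.
have := st_complexity_le (k + l) mn0.
have := @complexityM (3 ^ k * m) (3 ^ l * n); rewrite !muln_gt0 !expn_gt0 m0 n0.
rewrite mulnACA -expnD (complexity_st m0) ?(complexity_st n0) //.
by move=> /(_ isT isT); lia.
Qed.

Lemma st_complexity_mul_exp3_add1 a b k : 0 < a -> 0 < b -> stable_exponent a <= k ->
  st_complexity (b * (a * 3 ^ k + 1)) <= st_complexity a + st_complexity b + 1 + 3 * k.
Proof.
move=> a0 b0 hk.
have c0 : 0 < a * 3 ^ k + 1 by rewrite addn1.
apply: (leq_trans (st_complexityM b0 c0)).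
have := st_complexity_le 0 c0; rewrite mul1n.
have ak0 : 0 < 3 ^ k * a by rewrite muln_gt0 expn_gt0.
have := complexityD ak0 (ltn0Sn 0); rewrite complexity_st // complexity1.
by rewrite [3 ^ k * a]mulnC; lia.
Qed.

End Complexity.

(** * Defects *)

Section Defect.
Variable R : realType.

(** Three times the logarithm to base 3; the defect is the excess of the complexity over it. *)
Definition lg3 (n : nat) : R := 3 * (ln n%:R / ln 3).

Let ln3_gt0 : 0 < ln 3 :> R.
Proof. by apply: ln_gt0; rewrite ltr1n. Qed.

Let natpos n : (0 < n)%N -> (n%:R : R) \in Num.pos.
Proof. by rewrite posrE ltr0n. Qed.

Lemma lg3M m n : (0 < m)%N -> (0 < n)%N -> lg3 (m * n) = lg3 m + lg3 n.
Proof. by move=> m0 n0; rewrite /lg3 natrM lnM ?natpos //; ring. Qed.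

Lemma lg3_1 : lg3 1 = 0.
Proof. by rewrite /lg3 ln1 mul0r mulr0. Qed.

Lemma lg3_exp n k : (0 < n)%N -> lg3 (n ^ k) = k%:R * lg3 n.
Proof.
move=> n0; elim: k => [|k IH]; first by rewrite expn0 lg3_1 mul0r.
by rewrite expnS lg3M ?expn_gt0 ?n0 // IH -natr1 mulrDl mul1r addrC.
Qed.

Lemma lg3_3 : lg3 3 = 3.
Proof. by rewrite /lg3 divff ?mulr1 // gt_eqF. Qed.

Lemma ler_lg3 m n : (0 < m)%N -> (0 < n)%N -> (lg3 m <= lg3 n) = (m <= n)%N.
Proof.
move=> m0 n0; rewrite /lg3 ler_pM2l // ler_pM2r ?invr_gt0 //.
by rewrite ler_ln ?natpos // ler_nat.
Qed.

Lemma ltr_lg3 m n : (0 < m)%N -> (0 < n)%N -> (lg3 m < lg3 n) = (m < n)%N.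
Proof. by move=> m0 n0; rewrite !ltNge ler_lg3 // -ltnNge. Qed.

Lemma lg3_exp3 k n : (0 < n)%N -> lg3 (3 ^ k * n) = (3 * k)%:R + lg3 n.
Proof.
by move=> n0; rewrite lg3M ?expn_gt0 // lg3_exp // lg3_3 natrM mulrC.
Qed.

Lemma lg3_le_nat m k : (0 < m)%N -> (lg3 m <= k%:R) = (m ^ 3 <= 3 ^ k)%N.
Proof.
move=> m0; rewrite -ler_lg3 ?expn_gt0 ?m0 // !lg3_exp // lg3_3 mulrC.
by rewrite ler_pM2r.
Qed.

Lemma defectE n : defect R n = (complexity n)%:R - lg3 n.
Proof. by []. Qed.

Lemma defect_ge0 n : (0 < n)%N -> 0 <= defect R n.
Proof. by move=> n0; rewrite defectE subr_ge0 lg3_le_nat // complexity_ge. Qed.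

(* The least defect of a number that is not a power of 3, namely that of 2. *)
Definition defect_gap : R := 2 - lg3 2.

(** The weak inequality is 8 <= 9; equality would force 9 <= 8. *)
Lemma lg3_2_lt2 : lg3 2 < 2.
Proof.
rewrite lt_neqAle lg3_le_nat // andbT; apply/eqP => h.
have : lg3 9 <= lg3 8.
  by rewrite (_ : 9 = 3 ^ 2)%N // (_ : 8 = 2 ^ 3)%N // !lg3_exp // h lg3_3 mulrC.
by rewrite ler_lg3.
Qed.

Lemma defect_gap_gt0 : 0 < defect_gap.
Proof. by rewrite subr_gt0 lg3_2_lt2. Qed.

(* Powers of 3 are split off first because multiplying by 3 can leave
   the defect unchanged. *)
Variant defect_split (n : nat) : Prop :=
| SplitPow t m of (0 < m <= 2)%N & n = (3 ^ t * m)%N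
| SplitMul t a b of (0 < a)%N & (0 < b)%N & n = (3 ^ t * (a * b))%N &
    complexity n = (3 * t + (complexity a + complexity b))%N &
    defect R n = defect R a + defect R b &
    defect_gap <= defect R a & defect_gap <= defect R b
| SplitAdd t a b of (0 < a)%N & (0 < b)%N & n = (3 ^ t * (a + b))%N &
    complexity n = (3 * t + (complexity a + complexity b))%N &
    defect R a + defect_gap <= defect R n &
    (complexity b)%:R <= defect R n + 2.

(** Products and sums carry at least one gap by construction, and [3 ^ t * 2] costs at least
    [3 * t + 2] because its cube exceeds [3 ^ (3 * t + 1)]. *)
Lemma defect_split_gap n : defect_split n ->
  (exists t, n = (3 ^ t)%N) \/ defect_gap <= defect R n.
Proof.
have g0 := defect_gap_gt0.
case=> [t m m0|t a b a0 b0 _ _ -> ha hb|t a b a0 b0 _ _ ha _].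
- have [->|->] : m = 1%N \/ m = 2%N by lia.
    by rewrite muln1; left; exists t.
  move=> ->; right; rewrite defectE lg3_exp3 // /defect_gap.
  have : (3 * t + 2 <= complexity (3 ^ t * 2))%N.
    have p0 : (0 < 3 ^ t * 2)%N by rewrite muln_gt0 expn_gt0.
    rewrite leqNgt; apply/negP => h.
    have := complexity_ge p0; rewrite leqNgt => /negP; apply.
    apply: (@leq_ltn_trans (3 ^ (3 * t + 1))); first by rewrite leq_exp2l //; lia.
    by rewrite expnD expnMn -expnM [(t * 3)%N]mulnC ltn_pmul2l ?expn_gt0.
  rewrite -(ler_nat R) natrD; lra.
- by right; lra.
- by right; have := defect_ge0 a0; lra.
Qed.

Lemma defect_splitM3 t n : (0 < n)%N ->
  complexity (3 ^ t * n) = (3 * t + complexity n)%N ->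
  defect_split n -> defect_split (3 ^ t * n).
Proof.
move=> n0 ht.
have dn : defect R (3 ^ t * n) = defect R n.
  by rewrite !defectE ht lg3_exp3 // natrD; ring.
case=> [s m m0 e|s a b a0 b0 e c d ha hb|s a b a0 b0 e c ha hb].
- by apply: (@SplitPow _ (t + s) m) => //; rewrite e expnD mulnA.
- apply: (@SplitMul _ (t + s) a b); rewrite ?dn //; first by rewrite e expnD mulnA.
  by rewrite ht c; lia.
- apply: (@SplitAdd _ (t + s) a b); rewrite ?dn //; first by rewrite e expnD mulnA.
  by rewrite ht c; lia.
Qed.

Lemma defect_splitP n : (0 < n)%N -> defect_split n.
Proof.
have g0 := defect_gap_gt0.
elim/ltn_ind: n => n IH n0.
have [n1|n1] := leqP n 1.
  have -> : n = 1%N by lia.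
  exact: (@SplitPow _ 0 1).
have [a [b [/andP[a0 an] /andP[b0 bn] cn [nE|nE]]]] := complexity_decomp n1.
  wlog ba : a b a0 an b0 bn cn nE / (b <= a)%N.
    move=> wl; have [|/ltnW ab] := leqP b a; first exact: (wl a b).
    by apply: (wl b a); rewrite 1?addnC.
  have lgn : lg3 n <= lg3 a + lg3 2 by rewrite -lg3M // ler_lg3 //; lia.
  have dn : defect R n = defect R a + (complexity b)%:R - (lg3 n - lg3 a).
    by rewrite !defectE cn natrD; ring.
  have := defect_ge0 a0; have := lg3_2_lt2; move=> l2 da0.
  (* A summand [b] of at least 2 costs at least 2, while [n <= 2 * a] lets the logarithmic term grow
     by at most [lg3 2]. *)
  have [b2|b1] := leqP 2 b.
    have cb2 : 2 <= (complexity b)%:R :> R.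
      rewrite ler_nat leqNgt; apply/negP => cb.
      have := complexity_ge b0.
      have : (3 ^ complexity b <= 3 ^ 1)%N by rewrite leq_exp2l.
      have : (2 ^ 3 <= b ^ 3)%N by rewrite leq_exp2r.
      lia.
    apply: (@SplitAdd _ 0 a b); rewrite ?mul1n //.
      by rewrite dn /defect_gap; lra.
    by rewrite dn; lra.
  have {}b1 : b = 1%N by lia.
  (* For [3 <= a] the inequality 3 n <= 4 a bounds the growth of the logarithmic term by 2 [lg3 2] -
     3; the remaining sums are 2 and 3. *)
  subst b; have [a3|a2] := leqP 3 a.
    have lgn' : lg3 3 + lg3 n <= lg3 a + lg3 2 + lg3 2.
      rewrite -!lg3M ?muln_gt0 ?a0 // ler_lg3 ?muln_gt0 ?a0 ?n0 //. lia.
    rewrite lg3_3 in lgn'; rewrite complexity1 in dn cn.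
    apply: (@SplitAdd _ 0 a 1); rewrite ?mul1n ?complexity1 //.
      by rewrite dn /defect_gap; lra.
    by rewrite dn; lra.
  have [a1|{}a2] : a = 1%N \/ a = 2%N by lia.
    by apply: (@SplitPow _ 0 2) => //; rewrite nE a1.
  by apply: (@SplitPow _ 1 1) => //; rewrite nE a2.
(* A factor that is a power of 3 is stripped off and the splitting of the other factor is reused;
   otherwise both factors have defect at least [defect_gap]. *)
have pow t m : (0 < m)%N -> (m < n)%N -> n = (3 ^ t * m)%N ->
    complexity n = (complexity (3 ^ t) + complexity m)%N -> defect_split n.
  move=> m0 mn e c; rewrite e; apply: defect_splitM3 => //; last exact: IH.
  rewrite -e c complexity_exp3 //; case: t e {c} => // e.
  by rewrite e mul1n ltnn in mn.
have [[t at_]|ga] := defect_split_gap (IH a an a0).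
  by apply: (pow t b) => //; rewrite -at_.
have [[t bt]|gb] := defect_split_gap (IH b bn b0).
  by apply: (pow t a) => //; rewrite -bt 1?mulnC // addnC.
apply: (@SplitMul _ 0 a b); rewrite ?mul1n //.
by rewrite !defectE cn nE natrD lg3M //; ring.
Qed.

Lemma st_defectE n : (0 < n)%N -> st_defect R n = (st_complexity n)%:R - lg3 n.
Proof.
move=> n0; rewrite /st_defect defectE complexity_st_exponent // lg3_exp3 // natrD.
by ring.
Qed.

Lemma st_defectM3 k n : (0 < n)%N -> st_defect R (3 ^ k * n) = st_defect R n.
Proof.
move=> n0; rewrite !st_defectE ?muln_gt0 ?expn_gt0 //.
by rewrite st_complexity_mul3 // lg3_exp3 // natrD; ring.
Qed.

(* 3 log_3 of the ratio would be an integer, so the ratio is a power of 3. *)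
Lemma st_defect_eqD a b i j : ~~ (3 %| a)%N -> ~~ (3 %| b)%N ->
  st_defect R a + i%:R = st_defect R b + j%:R -> a = b /\ i = j.
Proof.
move=> a3 b3 h.
have a0 : (0 < a)%N by case: a a3 {h}.
have b0 : (0 < b)%N by case: b b3 {h}.
have key : (3 ^ (st_complexity a + i) * b ^ 3 = 3 ^ (st_complexity b + j) * a ^ 3)%N.
  have p0 x p : (0 < x)%N -> (0 < 3 ^ p * x ^ 3)%N.
    by move=> x0; rewrite muln_gt0 !expn_gt0 x0.
  have e : lg3 (3 ^ (st_complexity a + i) * b ^ 3) = lg3 (3 ^ (st_complexity b + j) * a ^ 3).
    rewrite !lg3_exp3 ?expn_gt0 ?a0 ?b0 // !lg3_exp // !natrM !natrD.
    move: h; rewrite !st_defectE //; lra.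
  by apply/eqP; rewrite eqn_leq -[X in X && _]ler_lg3 ?p0 // -[X in _ && X]ler_lg3 ?p0 // e lexx.
have ab : a = b.
  have cop x p : ~~ (3 %| x)%N -> coprime (x ^ 3) (3 ^ p).
    by move=> x3; apply/coprimeXl/coprimeXr; rewrite coprime_sym prime_coprime.
  apply/eqP; rewrite -(eqn_exp2r _ _ (isT : 0 < 3)%N) eqn_dvd; apply/andP; split.
    by rewrite -(Gauss_dvdr _ (cop a (st_complexity a + i) a3)) key dvdn_mull.
  by rewrite -(Gauss_dvdr _ (cop b (st_complexity b + j) b3)) -key dvdn_mull.
by split=> //; move/eqP: h; rewrite ab (inj_eq (addrI _)) eqr_nat => /eqP.
Qed.

End Defect.

(** * Sequences of low defect along an ultrafilter *)

Section UltraSequences.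
Local Open Scope nat_scope.
Variables (U : set_system nat) (UU : UltraFilter U).

(** This dichotomy takes the place of passing to a subsequence. *)
Lemma ultra_or (P Q : nat -> Prop) :
  (\forall i \near U, P i \/ Q i) ->
  (\forall i \near U, P i) \/ (\forall i \near U, Q i).
Proof.
move=> PQ; have [UP|UnP] := in_ultra_setVsetC (P : set nat) UU; first by left.
by right; apply: filterS2 PQ UnP => i [].
Qed.

Definition ultra_oo (f : nat -> nat) := forall K, \forall i \near U, K <= f i.

Lemma ultra_const (f : nat -> nat) K : (\forall i \near U, f i <= K) ->
  exists c, \forall i \near U, f i = c.
Proof.
elim: K => [|K IH] h; first by exists 0; apply: filterS h => i; lia.
have : \forall i \near U, f i = K.+1 \/ f i <= K by apply: filterS h => i; lia.
by case/ultra_or => [?|/IH//]; exists K.+1.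
Qed.

Lemma ultra_constVoo (f : nat -> nat) :
  (exists c, \forall i \near U, f i = c) \/ ultra_oo f.
Proof.
have [c|nc] := pselect (exists c, \forall i \near U, f i = c); [by left|right=> K].
have : \forall i \near U, f i <= K \/ K <= f i.
  by apply: filterE => i; have := leq_total (f i) K => /orP.
by case/ultra_or => // /ultra_const.
Qed.

Lemma ultra_ooD (f g : nat -> nat) : ultra_oo f -> ultra_oo (fun i => f i + g i).
Proof. by move=> fo K; apply: filterS (fo K) => i; lia. Qed.

(** Convergence of N / (c 3^t) to 1 from above along [U], written in integers: for every positive
    [M] the ratio eventually lies in [1, 1 + 1/M]. *)
Definition asymp3 (c : nat) (t N : nat -> nat) := forall M, \forall i \near U,
  c * 3 ^ t i <= N i /\ M * N i <= M.+1 * (c * 3 ^ t i).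

Lemma asymp3_eq c t N : (\forall i \near U, N i = c * 3 ^ t i) -> asymp3 c t N.
Proof. by move=> h M; apply: filterS h => i ->; split=> //; rewrite leq_mul2r leqnSn orbT. Qed.

Lemma asymp3M c t N c' t' N' : asymp3 c t N -> asymp3 c' t' N' ->
  asymp3 (c * c') (fun i => t i + t' i) (fun i => N i * N' i).
Proof.
move=> h h' M; have := h (M + M).+1; have := h' (M + M).+1.
(* The choice of parameter rests on (1 + 1/(2M+1))^2 <= 1 + 1/M. *)
apply: filterS2 => i [y1 y2] [x1 x2].
rewrite expnD mulnACA; move: (c * _) (c' * _) x1 x2 y1 y2 => x y x1 x2 y1 y2.
split; first exact: leq_mul.
rewrite -(@leq_pmul2l ((M + M).+1 * (M + M).+1)) //.
apply: (@leq_trans (M * ((M + M).+2 * x * ((M + M).+2 * y)))).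
  rewrite [leqLHS](_ : _ = M * (((M + M).+1 * N i) * ((M + M).+1 * N' i))); last by lia.
  by rewrite leq_mul2l leq_mul ?orbT.
by move: (x * y) (mulnACA (M + M).+2 x (M + M).+2 y) => z ->; nia.
Qed.

Lemma asymp3D c t N b : 0 < c -> ultra_oo t -> asymp3 c t N ->
  asymp3 c t (fun i => N i + b).
Proof.
(* Doubling [M] leaves half of the slack 1/M for [N] and half for the constant [b]. *)
move=> c0 too h M; have := h (M + M); have := too (M * b + M * b).
apply: filterS2 => i ti [x1 x2]; split; first by lia.
have : M * b + M * b <= c * 3 ^ t i.
  apply: (leq_trans ti); apply: (leq_trans (ltnW (ltn_expl (t i) (isT : 1 < 3)))).
  by rewrite leq_pmull.
by move: (c * _) x1 x2 => x *; lia.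
Qed.

Lemma asymp3_affine a b (k t N : nat -> nat) : 0 < a -> 0 < b -> ultra_oo k ->
  (\forall i \near U, N i = b * (a * 3 ^ k i + 1) * 3 ^ t i) ->
  asymp3 (a * b) (fun i => k i + t i) N.
Proof.
move=> a0 b0 koo h M; have := koo M; apply: filterS2 h => i -> ki.
rewrite expnD; have : M <= a * 3 ^ k i.
  apply: (leq_trans ki); apply: (leq_trans (ltnW (ltn_expl (k i) (isT : 1 < 3)))).
  by rewrite leq_pmull.
move: (3 ^ t i) (3 ^ k i) => y x Mx; split; first by nia.
have : M * (b * y) <= a * x * (b * y) by rewrite leq_mul2r Mx orbT.
by nia.
Qed.

(* Integrality makes the two approximating sequences equal. *)
Lemma asymp3_inj c t c' t' N : 0 < c -> 0 < c' -> asymp3 c t N -> asymp3 c' t' N ->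
  \forall i \near U, c * 3 ^ t i = c' * 3 ^ t' i.
Proof.
move=> c0 c'0 h h'; have := h (c + c').+1; have := h' (c + c').+1.
apply: filterS2 => i [y1 y2] [x1 x2].
have aux d d' s s' : 0 < d -> 0 < d' -> d + d' = c + c' -> s <= s' -> d * 3 ^ s <= N i ->
   d' * 3 ^ s' <= N i -> (c + c').+1 * N i <= (c + c').+2 * (d * 3 ^ s) ->
   (c + c').+1 * N i <= (c + c').+2 * (d' * 3 ^ s') -> d * 3 ^ s = d' * 3 ^ s'.
  move=> d0 d'0 dd /subnK <-; rewrite expnD mulnA -dd.
  have p0 : 0 < 3 ^ s by rewrite expn_gt0.
  move: (3 ^ s) p0 (d' * 3 ^ _) => p p0 e h1 h2 h3 h4; congr (_ * _).
  have e1 : (d + d').+1 * e <= (d + d').+2 * d.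
    by rewrite -(leq_pmul2r p0) -!mulnA; apply: leq_trans h3; rewrite leq_mul2l h2 orbT.
  have e2 : (d + d').+1 * d <= (d + d').+2 * e.
    by rewrite -(leq_pmul2r p0) -!mulnA; apply: leq_trans h4; rewrite leq_mul2l h1 orbT.
  (* The ratio is at most 1 + 1/(S+1), so [n <= S] gives [m < n + 1]. *)
  have squeeze m n S : S.+1 * m <= S.+2 * n -> n <= S -> m <= n.
    move=> mn nS; rewrite leqNgt; apply/negP => nm.
    have : S.+1 * n.+1 <= S.+1 * m by rewrite leq_mul2l nm orbT.
    by move: (S * m) (S * n) mn; lia.
  have ed : e <= d := squeeze _ _ _ e1 (leq_addr _ _).
  have de : d <= e := squeeze _ _ _ e2 (leq_trans ed (leq_addr _ _)).
  by apply/eqP; rewrite eqn_leq de.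
have [tt|/ltnW tt] := leqP (t i) (t' i); first exact: aux.
by apply/esym/aux => //; rewrite addnC.
Qed.

(* The sequences [N] at cost [w] that are built from powers of 3 by products
   and by adding constants, sorted by the number of additions to
   an unbounded quantity (none, one of the constant 1, total cost at least 2). *)
Variant low_defect (N w : nat -> nat) : Prop :=
| LowConst c t of 0 < c & \forall i \near U, N i = c * 3 ^ t i &
    \forall i \near U, st_complexity c + 3 * t i <= w i
| LowAffine a b k t of 0 < a & 0 < b & ultra_oo k &
    \forall i \near U, N i = b * (a * 3 ^ k i + 1) * 3 ^ t i &
    \forall i \near U, st_complexity a + st_complexity b + 1 + 3 * (k i + t i) <= w i
| LowHigh c t of 0 < c & ultra_oo t & asymp3 c t N &
    \forall i \near U, st_complexity c + 2 + 3 * t i <= w i.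

(** This merges the last two kinds: an affine sequence is asymptotic to a b 3^(k+t), and
    [st_complexityM] turns its cost bound into one for [a * b]. *)
Lemma low_defect_asymp N w : low_defect N w ->
  (exists c t, [/\ 0 < c, \forall i \near U, N i = c * 3 ^ t i &
    \forall i \near U, st_complexity c + 3 * t i <= w i]) \/
  exists c t, [/\ 0 < c, ultra_oo t, asymp3 c t N &
    \forall i \near U, st_complexity c + 1 + 3 * t i <= w i].
Proof.
case=> [c t c0 h1 h2|a b k t a0 b0 koo h1 h2|c t c0 too h1 h2].
- by left; exists c, t.
- right; exists (a * b), (fun i => k i + t i); split.
  + by rewrite muln_gt0 a0.
  + exact: ultra_ooD.
  + exact: asymp3_affine h1.
  + by apply: filterS h2 => i; have := st_complexityM a0 b0; lia.
- by right; exists c, t; split=> //; apply: filterS h2 => i; lia.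
Qed.

Lemma low_defect_near N w N' w' : (\forall i \near U, N i = N' i) ->
  (\forall i \near U, w i <= w' i) -> low_defect N w -> low_defect N' w'.
Proof.
move=> NN ww; case=> [c t c0 h1 h2|a b k t a0 b0 koo h1 h2|c t c0 too h1 h2].
- apply: (@LowConst _ _ c t) => //; first by apply: filterS2 NN h1 => i -> .
  by apply: filterS2 ww h2 => i; lia.
- apply: (@LowAffine _ _ a b k t) => //; first by apply: filterS2 NN h1 => i ->.
  by apply: filterS2 ww h2 => i; lia.
- apply: (@LowHigh _ _ c t) => //.
    by move=> M; apply: filterS2 NN (h1 M) => i ->.
  by apply: filterS2 ww h2 => i; lia.
Qed.

(** A constant times a power of 3 is absorbed into [c], or into the outer factor [b] of the affine
    kind, so the kind of the other factor is kept. *)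
Lemma low_defectM_const N w N' w' c t : 0 < c ->
  (\forall i \near U, N i = c * 3 ^ t i) ->
  (\forall i \near U, st_complexity c + 3 * t i <= w i) ->
  low_defect N' w' -> low_defect (fun i => N i * N' i) (fun i => w i + w' i).
Proof.
move=> c0 h1 h2; case=> [c' t' c'0 h1' h2'|a b k t' a0 b0 koo h1' h2'|c' t' c'0 too h1' h2'].
- apply: (@LowConst _ _ (c * c') (fun i => t i + t' i)); first by rewrite muln_gt0 c0.
    by apply: filterS2 h1 h1' => i -> ->; rewrite expnD mulnACA.
  by apply: filterS2 h2 h2' => i; have := st_complexityM c0 c'0; lia.
- apply: (@LowAffine _ _ a (c * b) k (fun i => t i + t' i)) => //; first by rewrite muln_gt0 c0.
    by apply: filterS2 h1 h1' => i -> ->; rewrite expnD; lia.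
  by apply: filterS2 h2 h2' => i; have := st_complexityM c0 b0; lia.
- apply: (@LowHigh _ _ (c * c') (fun i => t i + t' i)); first by rewrite muln_gt0 c0.
  + by move=> K; apply: filterS (too K) => i; lia.
  + by apply: asymp3M => //; apply: asymp3_eq.
  + by apply: filterS2 h2 h2' => i; have := st_complexityM c0 c'0; lia.
Qed.

(** When both factors involve an addition to an unbounded quantity, their two extra ones make the
    product [LowHigh]. *)
Lemma low_defectM N w N' w' : low_defect N w -> low_defect N' w' ->
  low_defect (fun i => N i * N' i) (fun i => w i + w' i).
Proof.
move=> h h'.
have [[c [t [c0 h1 h2]]]|[c [t [c0 too h1 h2]]]] := low_defect_asymp h.
  exact: (low_defectM_const c0 h1 h2).
have [[c' [t' [c'0 h1' h2']]]|[c' [t' [c'0 too' h1' h2']]]] := low_defect_asymp h'.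
  apply: low_defect_near (low_defectM_const c'0 h1' h2' h); apply: filterE => i.
    exact: mulnC.
  by rewrite addnC.
apply: (@LowHigh _ _ (c * c') (fun i => t i + t' i)); first by rewrite muln_gt0 c0.
- exact: ultra_ooD.
- exact: asymp3M.
- by apply: filterS2 h2 h2' => i; have := st_complexityM c0 c'0; lia.
Qed.

Lemma low_defectM3 N w t : low_defect N w ->
  low_defect (fun i => 3 ^ t i * N i) (fun i => 3 * t i + w i).
Proof.
apply: (@low_defectM_const _ _ _ _ 1 t) => //; first by apply: filterE => i; rewrite mul1n.
by apply: filterE => i; rewrite st_complexity1.
Qed.

(** A second addition to an unbounded quantity gives [LowHigh]. Otherwise N = c 3^t: for constant
    [t] the sum is a constant whose cost the complexity hypothesis bounds, and for unbounded [t] the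
    kind depends on whether [b] is 1. *)
Lemma low_defectD N w b : 0 < b ->
  (\forall i \near U, complexity (N i + b) <= w i + complexity b) ->
  low_defect N w -> low_defect (fun i => N i + b) (fun i => w i + complexity b).
Proof.
move=> b0 hw h.
have [[c [t [c0 h1 h2]]]|[c [t [c0 too h1 h2]]]] := low_defect_asymp h; last first.
  apply: (@LowHigh _ _ c t) => //; first exact: asymp3D.
  by apply: filterS h2 => i; have := complexity_gt0 b0; lia.
have [[s ts]|too] := ultra_constVoo t.
  apply: (@LowConst _ _ (c * 3 ^ s + b) (fun=> 0)); first by lia.
    by apply: filterS2 h1 ts => i -> ->; rewrite muln1.
  apply: filterS3 hw h1 ts => i hwi Ni ti; move: hwi; rewrite Ni ti.
  have p0 : 0 < c * 3 ^ s + b by lia.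
  by have := st_complexity_le 0 p0; rewrite mul1n; lia.
have [b1|b2] := leqP b 1.
  have {b0}b1 : b = 1 by lia.
  apply: (@LowAffine _ _ c 1 t (fun=> 0)) => //.
    by apply: filterS h1 => i ->; rewrite b1 mul1n muln1.
  by apply: filterS h2 => i; rewrite st_complexity1 b1 complexity1; lia.
apply: (@LowHigh _ _ c t) => //; first by apply: asymp3D => //; exact: asymp3_eq.
have cb : 1 < complexity b.
  rewrite ltnNge; apply/negP => cb.
  have := complexity_ge b0.
  have : 3 ^ complexity b <= 3 ^ 1 by rewrite leq_exp2l.
  have : 2 ^ 3 <= b ^ 3 by rewrite leq_exp2r.
  lia.
by apply: filterS h2 => i; lia.
Qed.

End UltraSequences.

(** * Sequences of bounded defect *)

Section Bounded.
Variables (R : realType) (U : set_system nat) (UU : UltraFilter U).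

Lemma nat_upper_bound (x : R) : exists K : nat, x <= K%:R.
Proof.
exists (Num.bound `|x|); apply: (le_trans (ler_norm x)).
exact: ltW (archi_boundP (normr_ge0 x)).
Qed.

(** Induction on the number of gaps. The ultrafilter selects one kind of splitting for almost all
    [i]; it leaves two factors, or one main summand, with defect below [k] gaps. *)
Lemma low_defect_bounded k (N : nat -> nat) :
  (\forall i \near U, (0 < N i)%N /\ defect R (N i) < k%:R * defect_gap R) ->
  low_defect U N (fun i => complexity (N i)).
Proof.
have g0 := defect_gap_gt0 R.
elim: k N => [|k IH] N h.
  have [i [N0]] := filter_ex h; rewrite mul0r => /lt_geF.
  by rewrite defect_ge0.
pose P1 i (q : nat * nat * nat) := let: (t, a, b) := q in
  (0 < a <= 2)%N /\ N i = (a * 3 ^ t)%N.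
pose P2 i (q : nat * nat * nat) := let: (t, a, b) := q in
  [/\ (0 < a)%N /\ defect R a < k%:R * defect_gap R,
      (0 < b)%N /\ defect R b < k%:R * defect_gap R,
      N i = (3 ^ t * (a * b))%N &
      complexity (N i) = (3 * t + (complexity a + complexity b))%N].
pose P3 i (q : nat * nat * nat) := let: (t, a, b) := q in
  [/\ (0 < a)%N /\ defect R a < k%:R * defect_gap R,
      (0 < b)%N /\ (complexity b)%:R <= k.+1%:R * defect_gap R + 2,
      N i = (3 ^ t * (a + b))%N &
      complexity (N i) = (3 * t + (complexity a + complexity b))%N].
have /choice[q qP] i : exists q, (0 < N i)%N /\ defect R (N i) < k.+1%:R * defect_gap R ->
    P1 i q \/ (P2 i q \/ P3 i q).
  have [[N0 dN]|nh] := pselect ((0 < N i)%N /\ defect R (N i) < k.+1%:R * defect_gap R); last first.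
    by exists (0%N, 0%N, 0%N).
  move: (dN); rewrite -natr1 mulrDl mul1r => dN'.
  have [t m m0 e|t a b a0 b0 e c d ha hb|t a b a0 b0 e c ha hb] := defect_splitP R N0.
  - by exists (t, m, 0%N) => _; left; split=> //; rewrite mulnC.
  - by exists (t, a, b) => _; right; left; split=> //; split=> //; lra.
  - by exists (t, a, b) => _; right; right; split=> //; split=> //; lra.
have {h}qP : \forall i \near U, P1 i (q i) \/ (P2 i (q i) \/ P3 i (q i)).
  by apply: filterS h => i; exact: qP.
pose t i := (q i).1.1; pose a i := (q i).1.2; pose b i := (q i).2.
have qE i : q i = (t i, a i, b i) by rewrite /t /a /b; case: (q i) => [[]].
have [h1|/(ultra_or UU)[h2|h3]] := ultra_or UU qP.
- have [|c ac] := @ultra_const U UU a 2.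
    by apply: filterS h1 => i; rewrite /P1 qE => -[]; lia.
  have [i [c0 Ni]] : exists i, (0 < c)%N /\ N i = (c * 3 ^ t i)%N.
    apply: (@filter_ex _ U); apply: filterS2 h1 ac => i; rewrite /P1 qE => -[a0 ->] <-.
    by split=> //; lia.
  have NE : \forall i \near U, N i = (c * 3 ^ t i)%N.
    by apply: filterS2 h1 ac => j; rewrite /P1 qE => -[_ ->] ->.
  apply: (@LowConst _ _ _ c t) => //.
  by apply: filterS NE => j ->; rewrite addnC [(c * _)%N]mulnC st_complexity_le.
- apply: (@low_defect_near _ UU (fun i => 3 ^ t i * (a i * b i))%N
    (fun i => 3 * t i + (complexity (a i) + complexity (b i)))%N).
  + by apply: filterS h2 => i; rewrite /P2 qE => -[_ _ -> _].
  + by apply: filterS h2 => i; rewrite /P2 qE => -[_ _ _ ->].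
  + apply: low_defectM3; apply: low_defectM.
      by apply: IH; apply: filterS h2 => i; rewrite /P2 qE => -[].
    by apply: IH; apply: filterS h2 => i; rewrite /P2 qE => -[].
(* The minor summand has bounded complexity, hence finitely many values, so it is constant along
   [U]. *)
- have [K hK] := nat_upper_bound (k.+1%:R * defect_gap R + 2).
  have [|c bc] := @ultra_const U UU b (3 ^ K).
    apply: filterS h3 => i; rewrite /P3 qE => -[_ [b0 cb] _ _].
    have {}cb : (complexity (b i) <= K)%N by rewrite -(ler_nat R) (le_trans cb).
    have := complexity_ge b0; have : (b i <= b i ^ 3)%N.
      by rewrite -{1}(expn1 (b i)) leq_pexp2l.
    have : (3 ^ complexity (b i) <= 3 ^ K)%N by rewrite leq_exp2l.
    lia.
  have {h3 qP}h3 : \forall i \near U, P3 i (t i, a i, c).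
    by apply: filterS2 h3 bc => i; rewrite qE => + <-.
  have [_ [_ [c0 _] _ _]] := filter_ex h3.
  apply: (@low_defect_near _ UU (fun i => 3 ^ t i * (a i + c))%N
    (fun i => 3 * t i + (complexity (a i) + complexity c))%N).
  + by apply: filterS h3 => i; rewrite /P3 => -[_ _ -> _].
  + by apply: filterS h3 => i; rewrite /P3 => -[_ _ _ ->].
  + apply: low_defectM3; apply: (low_defectD UU c0).
      by apply: filterS h3 => i -[[a0 _] _ _ _]; exact: complexityD.
    by apply: IH; apply: filterS h3 => i -[].
Qed.

Lemma low_defect_of_le (C : R) (N : nat -> nat) :
  (\forall i \near U, (0 < N i)%N /\ defect R (N i) <= C) ->
  low_defect U N (fun i => complexity (N i)).
Proof.
move=> h; have [k kC] := nat_upper_bound (C / defect_gap R).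
apply: (@low_defect_bounded k.+1); apply: filterS h => i [-> dN]; split=> //.
apply: (le_lt_trans dN); rewrite -natr1 mulrDl mul1r.
apply: (@le_lt_trans _ _ (k%:R * defect_gap R)).
  by rewrite -ler_pdivrMr ?defect_gap_gt0.
by rewrite ltrDl defect_gap_gt0.
Qed.

End Bounded.

(** * Limit points of stable defects *)

Lemma exp3_split n : (0 < n)%N -> exists v m, n = (3 ^ v * m)%N /\ ~~ (3 %| m)%N.
Proof.
move=> n0; have [m cm e] := pfactor_coprime (isT : prime 3) n0.
by exists (logn 3 n), m; rewrite mulnC; split=> //; rewrite -prime_coprime.
Qed.

Lemma ndvd3_gt0 n : ~~ (3 %| n)%N -> (0 < n)%N.
Proof. by case: n. Qed.

Lemma exp3_split_inj (p q m n : nat) : ~~ (3 %| m)%N -> ~~ (3 %| n)%N ->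
  (3 ^ p * m = 3 ^ q * n)%N -> m = n.
Proof.
wlog pq : p q m n / (p <= q)%N.
  move=> wl m3 n3 e; have [|/ltnW] := leqP p q; first by move/wl; apply.
  by move/wl => h; apply/esym/h.
move=> m3 n3; rewrite -(subnKC pq) expnD -mulnA => /eqP.
rewrite eqn_pmul2l ?expn_gt0 // => /eqP.
case: (q - p)%N => [|r] e; first by rewrite e mul1n.
by move: m3; rewrite e expnS -mulnA dvdn_mulr.
Qed.

Lemma exists_ultra_nat : exists U : set_system nat, UltraFilter U /\ \oo `<=` U.
Proof. exact: ultraFilterLemma. Qed.

Section LimitPoints.
Variable R : realType.

(** For positive [M] the difference is at most 3 ln(1 + 1/M) / ln 3, which is at most 3 / (M ln
    3). *)
Lemma lg3_close (e : R) : 0 < e -> exists M, forall x n : nat,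
  (0 < x <= n)%N -> (M * n <= M.+1 * x)%N -> lg3 R n - lg3 R x < e.
Proof.
move=> e0; have l3 : 0 < ln 3 :> R by apply: ln_gt0; rewrite ltr1n.
have [K hK] := nat_upper_bound (3 / ln 3 / e).
exists K.+1 => x n /andP[x0 xn] h; have n0 : (0 < n)%N := leq_trans x0 xn.
have : lg3 R K.+1 + lg3 R n <= lg3 R K.+2 + lg3 R x.
  by rewrite -!lg3M // ler_lg3 // muln_gt0 ?x0 ?n0.
suff : lg3 R K.+2 - lg3 R K.+1 < e by lra.
have K0 : 0 < K.+1%:R :> R by rewrite ltr0n.
rewrite /lg3 -mulrBr -mulrBl -ln_div ?posrE ?ltr0n //.
have -> : K.+2%:R / K.+1%:R = 1 + K.+1%:R^-1 :> R.
  by rewrite -[K.+2%:R]natr1 mulrDl divff ?gt_eqF // mul1r.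
have : ln (1 + K.+1%:R^-1) <= K.+1%:R^-1 :> R.
  by apply: le_ln1Dx; rewrite (lt_trans (ltrN10 _)) // invr_gt0.
move=> hl; apply: (@le_lt_trans _ _ (3 / ln 3 / K.+1%:R)).
  by rewrite mulrCA mulrC ler_wpM2l // divr_ge0 // ltW.
rewrite ltr_pdivrMr // [e * _]mulrC -ltr_pdivrMr //; apply: (le_lt_trans hK).
by rewrite ltr_nat.
Qed.

Lemma complexity_eventually a b : (0 < a)%N -> (0 < b)%N ->
  st_complexity (a * b) = (st_complexity a + st_complexity b)%N ->
  \forall k \near \oo, st_complexity (b * (a * 3 ^ k + 1)) =
    (st_complexity a + st_complexity b + 1 + 3 * k)%N.
Proof.
move=> a0 b0 ab; apply: contrapT => nK.
pose x k := (b * (a * 3 ^ k + 1))%N.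
have x0 k : (0 < x k)%N by rewrite muln_gt0 b0 addn1.
have ab0 : (0 < a * b)%N by rewrite muln_gt0 a0.
(* If the formula fails for arbitrarily large [k], then [f] collects exponents at which at least 1
   is saved against the naive cost. *)
have /choice[f fP] K : exists k, (K <= k)%N /\
    (st_complexity (x k) <= st_complexity (a * b) + 3 * k)%N.
  apply: contrapT => hK; apply: nK.
  near=> k; have kK : (K <= k)%N by near: k; exact: nbhs_infty_ge.
  have ka : (stable_exponent a <= k)%N by near: k; exact: nbhs_infty_ge.
  have := st_complexity_mul_exp3_add1 a0 b0 ka.
  have [h|] := leqP (st_complexity (x k)) (st_complexity (a * b) + 3 * k); last first.
    by rewrite /x ab; lia.
  by case: hK; exists k.
have [U [UU ooU]] := exists_ultra_nat.
pose e i := stable_exponent (x (f i)); pose N i := (3 ^ e i * x (f i))%N.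
have N0 i : (0 < N i)%N by rewrite muln_gt0 expn_gt0 x0.
have foo : ultra_oo U f.
  move=> K; apply: ooU; exists K => // i /= Ki.
  by apply: leq_trans Ki _; case: (fP i).
have NE : \forall i \near U, N i = (b * (a * 3 ^ f i + 1) * 3 ^ e i)%N.
  by apply: filterE => i; rewrite /N /x mulnC.
have Nasymp := asymp3_affine UU a0 b0 foo NE.
have cN i : complexity (N i) = (3 * e i + st_complexity (x (f i)))%N.
  exact: complexity_st_exponent.
have : low_defect U N (fun i => complexity (N i)).
  apply: (@low_defect_of_le R U UU (st_defect R (a * b))).
  apply: filterE => i; split=> //.
  rewrite defectE st_defectE // cN lg3_exp3 // natrD.
  have : lg3 R (3 ^ f i * (a * b)) <= lg3 R (x (f i)).
    by rewrite ler_lg3 ?muln_gt0 ?expn_gt0 ?a0 // /x; lia.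
  rewrite lg3_exp3 //.
  by have := (fP i).2; rewrite -(ler_nat R) natrD; lra.
(* In the constant case [N i] would equal [a * b * 3 ^ (f i + e i)], which is strictly smaller;
   otherwise the extra 1 in the lower bound contradicts the saving. *)
move=> /(low_defect_asymp UU)[[c [t [c0 h1 h2]]]|[c [t [c0 _ h1 h2]]]].
  have [i [Ni [Ei ]]] := filter_ex (filterI h1
    (filterI NE (asymp3_inj UU c0 ab0 (asymp3_eq UU h1) Nasymp))).
  by rewrite -Ni Ei expnD; have : (0 < 3 ^ e i)%N; [rewrite expn_gt0|nia].
have [i [Ei ci]] := filter_ex (filterI (asymp3_inj UU c0 ab0 h1 Nasymp) h2).
have : (st_complexity c + 3 * t i = st_complexity (a * b) + 3 * (f i + e i))%N.
  have := st_complexity_mul3 (t i) c0; rewrite mulnC Ei mulnC st_complexity_mul3 //.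
  by lia.
by have := (fP i).2; move: ci; rewrite cN; lia.
Unshelve. all: by end_near.
Qed.

Lemma natr3_Z3 k : (3 * k)%:R = 0 :> 'Z_3.
Proof. by rewrite natrM (_ : 3%:R = 0) ?mul0r //; apply/val_inj. Qed.

(** Powers of 3 in the constants move into the exponents, so that [c] is not divisible by 3 and is
    determined by its stable defect. *)
Lemma low_defect_normal U (UU : UltraFilter U) (N w : nat -> nat) : low_defect U N w ->
  (exists c t, ~~ (3 %| c)%N /\ \forall i \near U, N i = (3 ^ t i * c)%N) \/
  exists c t, [/\ ~~ (3 %| c)%N, asymp3 U c t N,
    \forall i \near U, (st_complexity c + 1 + 3 * t i <= w i)%N &
    (\forall i \near U, (st_complexity c + 2 + 3 * t i <= w i)%N) \/
    exists a b, [/\ (a * b)%N = c,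
      \forall i \near U, (st_complexity a + st_complexity b + 1 + 3 * t i <= w i)%N &
      \forall i \near U, exists k s, (0 < k)%N /\ N i = (3 ^ s * (b * (a * 3 ^ k + 1)))%N]].
Proof.
case=> [c t c0 h1 h2|a b k t a0 b0 koo h1 h2|c t c0 too h1 h2].
- left; have [v [c' [e c3]]] := exp3_split c0.
  exists c', (fun i => t i + v)%N; split=> //.
  by apply: filterS h1 => i ->; rewrite e expnD; lia.
- have [x [a' [ea a3]]] := exp3_split a0; have [y [b' [eb b3]]] := exp3_split b0.
  have [a'0 b'0] := (ndvd3_gt0 a3, ndvd3_gt0 b3).
  have ea' : (st_complexity a = 3 * x + st_complexity a')%N.
    by rewrite ea st_complexity_mul3.
  have eb' : (st_complexity b = 3 * y + st_complexity b')%N.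
    by rewrite eb st_complexity_mul3.
  right; exists (a' * b')%N, (fun i => (k i + t i) + (x + y))%N; split.
  + by rewrite Euclid_dvdM // negb_or a3.
  + move=> M; apply: filterS (asymp3_affine UU a0 b0 koo h1 M) => i.
    rewrite [(a * b * _)%N](_ : _ = (a' * b' * 3 ^ (k i + t i + (x + y)))%N) //.
    by rewrite ea eb !expnD; lia.
  + by apply: filterS h2 => i; have := st_complexityM a'0 b'0; lia.
  + right; exists a', b'; split=> //; first by apply: filterS h2 => i; lia.
    apply: filterS2 h1 (koo 1%N) => i -> ki; exists (k i + x)%N, (y + t i)%N.
    by split; [lia|rewrite ea eb !expnD; lia].
- right; have [v [c' [e c3]]] := exp3_split c0; have c'0 := ndvd3_gt0 c3.
  have ec : (st_complexity c = 3 * v + st_complexity c')%N.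
    by rewrite e st_complexity_mul3.
  exists c', (fun i => t i + v)%N; split=> //.
  + move=> M; apply: filterS (h1 M) => i.
    by rewrite [(c * _)%N](_ : _ = (c' * 3 ^ (t i + v))%N) // e expnD; lia.
  + by apply: filterS h2 => i; lia.
  + by left; apply: filterS h2 => i; lia.
Qed.

(** The stabilised sequence [N] has bounded defect along a free ultrafilter and is not of the
    constant kind, since [m] leaves every value. The number [j] is its cost beyond that of c 3^t. *)
Lemma limit_defect (C : R) (m : nat -> nat) :
  (forall i, ~~ (3 %| m i)%N) -> (forall i, st_defect R (m i) <= C) ->
  (forall v, \forall i \near \oo, m i <> v) ->
  exists c j, [/\ ~~ (3 %| c)%N, (0 < j)%N &
    forall e : R, 0 < e -> forall i0, exists2 i, (i0 <= i)%N &
      [/\ st_defect R c + j%:R - e < st_defect R (m i) < st_defect R c + j%:R,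
          (st_complexity (m i))%:R = (st_complexity c)%:R + j%:R :> 'Z_3 &
          j = 1%N -> exists k a b, [/\ (a * b)%N = c,
            st_complexity c = (st_complexity a + st_complexity b)%N &
            st_defect R (m i) = st_defect R (b * (a * 3 ^ k + 1))]]].
Proof.
move=> m3 mC mv; have [U [UU ooU]] := exists_ultra_nat.
have m0 i := ndvd3_gt0 (m3 i).
pose s i := stable_exponent (m i); pose N i := (3 ^ s i * m i)%N.
have N0 i : (0 < N i)%N by rewrite muln_gt0 expn_gt0 m0.
have cN i : complexity (N i) = (3 * s i + st_complexity (m i))%N.
  exact: complexity_st_exponent.
have dN i : st_defect R (m i) = (complexity (N i))%:R - lg3 R (N i) by [].
have nconst c t : ~~ (3 %| c)%N -> ~ \forall i \near U, N i = (3 ^ t i * c)%N.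
  move=> c3 h; have [i [Ni mi]] := filter_ex (filterI h (ooU _ (mv c))).
  exact/mi/(exp3_split_inj _ _ Ni).
have : low_defect U N (fun i => complexity (N i)).
  by apply: (@low_defect_of_le R U UU C); apply: filterE => i; split=> //; exact: mC.
move=> /(low_defect_normal UU)[[c [t [c3 h]]]|[c [t [c3 h1 h2 h3]]]].
  by have := nconst _ _ c3 h.
have c0 := ndvd3_gt0 c3.
(* From N <= 2 c 3^t and the bound [C] on the defect, [complexity (N i) - 3 * t i] is bounded, hence
   constant along [U]. *)
have [W hW] : exists W, \forall i \near U, complexity (N i) = (W + 3 * t i)%N.
  have [K hK] := nat_upper_bound (C + lg3 R (c + c)).
  have [|W hW] := @ultra_const U UU (fun i => complexity (N i) - 3 * t i)%N K.
    apply: filterS (h1 1%N) => i [_ N2].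
    have := mC i; rewrite dN => dNi.
    have : lg3 R (N i) <= lg3 R (3 ^ t i * (c + c)).
      rewrite ler_lg3 ?N0 ?muln_gt0 ?expn_gt0 ?addn_gt0 ?c0 //.
      by move: N2; rewrite mul1n; move: (3 ^ t i)%N => p; lia.
    rewrite (@lg3_exp3 _ (t i) (c + c)%N) ?addn_gt0 ?c0 // => l2.
    by rewrite leq_subLR -(ler_nat R) natrD; lra.
  by exists W; apply: filterS2 hW h2 => i; lia.
have Wc : (st_complexity c + 1 <= W)%N.
  by have [i [Wi]] := filter_ex (filterI hW h2); rewrite Wi; lia.
pose j := (W - st_complexity c)%N.
exists c, j; split=> //; first by rewrite /j; lia.
move=> e e0 i0; have [M hM] := lg3_close e0.
(* [N i] strictly above its approximation makes the defect strictly smaller than the limit. *)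
have hN : \forall i \near U, N i <> (c * 3 ^ t i)%N.
  have [h|//] := in_ultra_setVsetC [set i | N i = (c * 3 ^ t i)%N] UU.
  by case: (@nconst c t) => //; apply: filterS h => i /= ->; rewrite mulnC.
have hj : \forall i \near U, j = 1%N -> exists k a b, [/\ (a * b)%N = c,
    st_complexity c = (st_complexity a + st_complexity b)%N &
    st_defect R (m i) = st_defect R (b * (a * 3 ^ k + 1))].
  have [h3'|[a [b [ab ha hk]]]] := h3.
    by apply: filterS2 h3' hW => i h Wi; rewrite Wi in h; rewrite /j; lia.
  have [a0 b0] : (0 < a)%N /\ (0 < b)%N by apply/andP; rewrite -muln_gt0 ab.
  apply: filterS3 ha hk hW => i hai [k [r [k0 Ni]]] Wi j1.
  exists k, a, b; split=> //.
    (* Exactly one extra 1 forces equality in [st_complexityM]. *)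
    rewrite Wi in hai; have := st_complexityM a0 b0; rewrite ab.
    by move: j1; rewrite /j; lia.
  have p0 : (0 < b * (a * 3 ^ k + 1))%N by rewrite muln_gt0 b0 addn1.
  by rewrite -(st_defectM3 R r p0) -Ni st_defectM3.
have hi : \forall i \near U, (i0 <= i)%N by apply: ooU; exists i0.
have [i [[Ni [xN MN]] [[ii ji] Wi]]] := filter_ex (filterI
  (filterI hN (h1 M)) (filterI (filterI hi hj) hW)).
have x0 : (0 < c * 3 ^ t i)%N by rewrite muln_gt0 c0 expn_gt0.
exists i => //; split=> //.
- have := hM _ _ (introT andP (conj x0 xN)) MN.
  have : lg3 R (c * 3 ^ t i) < lg3 R (N i).
    by rewrite ltr_lg3 // ltn_neqAle xN andbT; apply/eqP => /esym.
  rewrite dN Wi st_defectE // [(c * _)%N]mulnC lg3_exp3 //.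
  have -> : (W + 3 * t i)%:R = (st_complexity c)%:R + j%:R + (3 * t i)%:R :> R.
    by rewrite -!natrD /j; congr (_%:R); lia.
  by move=> l1 l2; apply/andP; split; lra.
- have := cN i; rewrite Wi => /(congr1 (fun n => n%:R : 'Z_3)).
  rewrite (natrD _ W) (natrD _ (3 * s i)%N) !natr3_Z3 addr0 add0r => <-.
  by rewrite -natrD /j subnKC //; lia.
Qed.

End LimitPoints.

(** * Order types *)

Lemma infinite_seq T (A : set T) : infinite_set A ->
  exists2 y : nat -> T, injective y & forall i, A (y i).
Proof.
move=> /infiniteP /card_leP [f].
exists (fun i => val (f (SigSub (mem_set (I : [set: nat] i))))) => [i j e|i].
  have /(_ _ _ _ _ (val_inj e)) := @inj _ _ _ f.
  by rewrite !inE => /(_ I I) [].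
exact: set_valP.
Qed.

Lemma injective_near (T : Type) (y : nat -> T) : injective y ->
  forall v, \forall i \near \oo, y i <> v.
Proof.
move=> yi v; have [[i0 e]|ne] := pselect (exists i, y i = v).
  exists i0.+1 => // i /= ii; rewrite -e => /yi ei; by rewrite ei ltnn in ii.
by apply: filterE => i e; apply: ne; exists i.
Qed.

Definition well_ordered (R : realType) (S : set R) := forall A : set R,
  A `<=` S -> A !=set0 -> exists2 x, A x & forall y, A y -> x <= y.

Section OrderTypes.
Variable R : realType.
Implicit Types (S X Y : set R) (g alpha : ordinal_number).

Lemma order_type_intro S g (f : g -> R) :
  (forall a b, olt a b -> f a < f b) -> (forall a, S (f a)) ->
  (forall y, S y -> exists a, f a = y) -> has_order_type S g.
Proof.
move=> fm fS Sf.
have fmono a b : olt a b <-> f a < f b.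
  split; [exact: fm|move=> ab; have [//|[e|/fm]] := olt_total a b].
    by rewrite e ltxx in ab.
  by move=> /(lt_trans ab); rewrite ltxx.
exists f => //; split=> [a _|a b _ _ e|y /Sf[a <-]]; [exact: fS| |by exists a].
by have [/fm|[//|/fm]] := olt_total a b; rewrite e ltxx.
Qed.

(** By well-founded induction the two enumerations of initial segments of [S] by [g] agree, so
    neither endpoint lies in the other segment. *)
Lemma elt_at_unique S g x y : elt_at S g x -> elt_at S g y -> x = y.
Proof.
move=> [Sx [f [fS fi fs] fm]] [Sy [h [hS hi hs] hm]].
(* If [f' a < h' a], then [f' a] is [h' b] for some [b] below [a], where the two maps already
   agree. *)
have aux (x' y' : R) (f' h' : g -> R) a : set_fun setT [set z | S z /\ z < x'] f' ->
    set_fun setT [set z | S z /\ z < y'] h' ->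
    set_surj setT [set z | S z /\ z < y'] h' ->
    (forall a b, olt a b <-> f' a < f' b) -> (forall a b, olt a b <-> h' a < h' b) ->
    (forall b, olt b a -> f' b = h' b) -> ~ f' a < h' a.
  move=> f'S h'S h's f'm h'm IH fh.
  have [Sf _] := f'S a I; have [_ hy] := h'S a I.
  have [b _ hb] : (h' @` setT) (f' a) by apply: h's; split=> //; exact: lt_trans hy.
  have ba : olt b a by apply/h'm; rewrite hb.
  by move/f'm: (ba); rewrite IH // hb ltxx.
have fh a : f a = h a.
  elim/(well_founded_ind (@olt_wf g)): a => a IH.
  have n1 := aux x y f h a fS hS hs fm hm IH.
  have n2 := aux y x h f a hS fS fs hm fm (fun b ba => esym (IH b ba)).
  by apply/eqP; rewrite eq_le !leNgt; apply/andP; split; apply/negP.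
have [xy|yx|//] := ltgtP x y.
- have [a _ ax] : (h @` setT) x by apply: hs.
  by have [_] := fS a I; rewrite fh ax ltxx.
- have [a _ ay] : (f @` setT) y by apply: fs.
  by have [_] := hS a I; rewrite -fh ay ltxx.
Qed.

Section InitialSegment.
Variables (S : set R) (x : R).

(** The ordinal that indexes [x] is realised as the initial segment of [S] below [x] itself. *)
Let carrier := {y : R | S y /\ y < x}.
Let lt (a b : carrier) := sval a < sval b.

Lemma segment_trans (a b c : carrier) : lt a b -> lt b c -> lt a c.
Proof. exact: lt_trans. Qed.

Lemma segment_total (a b : carrier) : lt a b \/ a = b \/ lt b a.
Proof.
have [|?|e] := ltgtP (sval a) (sval b); [by left|by right; right|].
right; left; case: a b e => [a aP] [b bP] /= e; subst b.
by rewrite (Prop_irrelevance aP bP).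
Qed.

Lemma segment_wf : well_ordered S -> well_founded lt.
Proof.
move=> Swo a; apply: contrapT => na.
have [||z [b nb <-] bmin] := Swo [set sval b | b in [set b | ~ Acc lt b]].
- by move=> _ [b _ <-]; case: (svalP b).
- by exists (sval a), a.
- apply: nb; constructor=> c cb; apply: contrapT => nc.
  by have := bmin (sval c) (ex_intro2 _ _ c nc erefl); rewrite leNgt => /negP; apply.
Qed.

Lemma elt_at_exists : well_ordered S -> S x -> exists g, elt_at S g x.
Proof.
move=> Swo Sx; pose g := OrdinalNumber segment_trans segment_total (segment_wf Swo).
exists g; split=> //; apply: (@order_type_intro _ g (fun a : carrier => sval a)) => //.
- by move=> a; exact: (svalP a).
- by move=> y Sy; exists (exist _ y Sy).
Qed.

End InitialSegment.

Lemma order_type_addn S g (z : nat -> R) k : has_order_type S g ->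
  (forall i j, (i < j)%N -> z i < z j) -> (forall y i, S y -> y < z i) ->
  has_order_type [set y | S y \/ exists2 i, (i < k)%N & z i = y] (oadd g (ofin k)).
Proof.
move=> [f [fS fi fs] fm] zm Sz.
pose h (a : oadd g (ofin k)) := match a with inl p => f p | inr i => z i end.
apply: (@order_type_intro _ _ h).
- move=> a b []; rewrite /h.
  + by move=> p q /fm.
  + by move=> p i; apply: Sz; exact: fS.
  + by move=> i j; exact: zm.
- by case=> [p|i]; [left; exact: fS|right; exists i].
- move=> y [/fs[p _ <-]|[i ik <-]]; first by exists (inl p).
  by exists (inr (Ordinal ik)).
Qed.

(** Iterating the successor map from the least element gives the enumeration; an element it misses
    would lie above all its values, against the finiteness of initial segments. *)
Lemma enumerate_omega S : infinite_set S -> well_ordered S ->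
  (forall z, S z -> finite_set [set y | S y /\ y <= z]) ->
  exists e : nat -> R, [/\ forall i, S (e i), forall i j, (i < j)%N -> e i < e j &
    forall y, S y -> exists i, e i = y].
Proof.
move=> Sinf Swo Sfin.
have [z0 Sz0 z0min] := Swo S (fun _ h => h) (infinite_setN0 Sinf).
have /choice[next nextP] z : exists z', S z ->
    [/\ S z', z < z' & forall y, S y -> z < y -> z' <= y].
  have [Sz|nSz] := pselect (S z); last by exists 0.
  have [||z' [Sz' zz'] z'min] := Swo [set y | S y /\ z < y]; first by move=> y [].
    apply/set0P/negP => /eqP e; apply: Sinf; apply: sub_finite_set (Sfin _ Sz).
    move=> y Sy; split=> //; rewrite leNgt; apply/negP => zy.
    by have : [set y | S y /\ z < y] y by []; rewrite e.
  by exists z' => _; split=> // y Sy zy; apply: z'min.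
pose e i := iter i next z0.
have eS i : S (e i) by elim: i => //= i /nextP[].
have e_lt i j : (i < j)%N -> e i < e j.
  elim: j => // j IH; rewrite ltnS leq_eqVlt => /orP[/eqP ->|/IH ij].
    by case: (nextP _ (eS j)).
  by apply: (lt_trans ij); case: (nextP _ (eS j)).
exists e; split=> // y Sy; apply: contrapT => ney.
have ey i : e i < y.
  elim: i => [|i IH]; rewrite lt_neqAle; apply/andP; split.
  - by apply/eqP => h; apply: ney; exists 0%N.
  - exact: z0min.
  - by apply/eqP => h; apply: ney; exists i.+1.
  - by case: (nextP _ (eS i)) => _ _; apply.
have e_inj : injective e.
  by move=> i j eij; case: (ltngtP i j) => // /e_lt; rewrite eij ltxx.
have : infinite_set (range e).
  by rewrite (eq_finite_set (inj_card_eq _)); [exact: infinite_nat|exact: in2W].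
apply; apply: sub_finite_set (Sfin _ Sy) => _ [i _ <-]; split=> //.
exact: ltW.
Qed.

(* With X = D^u and Y = D^(u+1), the fiber of D^u[alpha] consists of the
   D^(u+1)[omega alpha + k]. *)
Definition fiber X Y x : set R :=
  [set y | [/\ Y y, y < x + 1 & forall x', X x' -> x' < x -> x' + 1 <= y]].

(** * Concatenation of fibers into omega times alpha *)

Section FiberBlock.
Variables (X Y : set R) (x : R) (alpha : ordinal_number).
Hypotheses (Xwo : well_ordered X) (Ywo : well_ordered Y).
Hypothesis fiber_inf : forall x', X x' -> infinite_set (fiber X Y x').
Hypothesis fiber_fin : forall x' z, X x' -> z < x' + 1 ->
  finite_set [set y | fiber X Y x' y /\ y <= z].
Hypothesis x_at : elt_at X alpha x.

Lemma fiber_block : exists e : nat -> R,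
  [/\ forall k, elt_at Y (oadd (omul omega alpha) (ofin k)) (e k),
      elt_at Y (omul omega alpha) (e 0%N),
      block Y alpha = fiber X Y x &
      fiber X Y x = Y `&` `[e 0%N, x + 1[].
Proof.
have [Xx [g [gS gi gs] gm]] := x_at.
have /choice[E EP] x' : exists e : nat -> R, X x' ->
    [/\ forall i, fiber X Y x' (e i), forall i j, (i < j)%N -> e i < e j &
    forall y, fiber X Y x' y -> exists i, e i = y].
  have [Xx'|nX] := pselect (X x'); last by exists (fun=> 0).
  have [||z [_ zx _]|e eP] := @enumerate_omega (fiber X Y x').
  - exact: fiber_inf.
  - by move=> A AF; apply: Ywo => y /AF [].
  - exact: fiber_fin.
  - by exists e.
have Efib x' i : X x' -> fiber X Y x' (E x' i) by move=> /EP[].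
have Elt x' i j : X x' -> (i < j)%N -> E x' i < E x' j by move=> /EP[_ + _]; apply.
have Esurj x' y : X x' -> fiber X Y x' y -> exists i, E x' i = y.
  by move=> /EP[_ _]; apply.
(* Such a [y] belongs to the fiber of the least [x'] with [y < x' + 1]. *)
have ofiber y : Y y -> y < x + 1 -> exists2 x', X x' /\ x' <= x & fiber X Y x' y.
  move=> Yy yx; have [||x' [Xx' yx'] x'min] := Xwo (A := [set x' | X x' /\ y < x' + 1]).
  - by move=> ? [].
  - by exists x.
  - exists x'; first by split=> //; exact: x'min.
    split=> // x'' Xx'' lt''; rewrite leNgt; apply/negP => h.
    by have := x'min x'' (conj Xx'' h); rewrite leNgt lt''.
have gX p : X (g p) by case: (gS p I).
have gx p : g p < x by case: (gS p I).
(* The first coordinate selects a fiber below that of [x], the second a position in it. *)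
pose h (q : omul omega alpha) : R := E (g q.1) q.2.
have E0le i : E x 0 <= E x i.
  by case: i => // i; apply/ltW/Elt.
have hx q i : h q < E x i.
  have [_ + _] := Efib _ q.2 (gX q.1); move=> /lt_le_trans; apply.
  by have [_ _] := Efib _ i Xx; apply.
have type0 : has_order_type [set y | Y y /\ y < E x 0] (omul omega alpha).
  apply: (@order_type_intro _ _ h).
  - move=> _ _ [p q i j /gm pq|p i j ij]; rewrite /h /=; last exact: Elt.
    have [_ + _] := Efib _ i (gX p); move=> /lt_le_trans; apply.
    by have [_ _] := Efib _ j (gX q); apply.
  - by move=> q; split; [case: (Efib _ q.2 (gX q.1))|exact: hx].
  - move=> y [Yy y0]; have [_ E0x _] := Efib _ 0%N Xx.
    have [x' [Xx' x'x] fx'] := ofiber y Yy (lt_trans y0 E0x).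
    have {}x'x : x' < x.
      rewrite lt_neqAle x'x andbT; apply/eqP => e; rewrite e in fx'.
      by have [i ei] := Esurj _ _ Xx fx'; have := E0le i; rewrite ei leNgt y0.
    have [p _ gp] : (g @` setT) x' by apply: gs.
    have [i ei] := Esurj _ _ Xx' fx'.
    by exists (p, i); rewrite /h /= gp.
have fibE : fiber X Y x = Y `&` `[E x 0, x + 1[.
  apply/seteqP; split=> y /=; rewrite in_itv /=.
    move=> fy; have [i <-] := Esurj _ _ Xx fy; have [Yi ix _] := Efib _ i Xx.
    by rewrite E0le ix.
  move=> [Yy /andP[y0 yx]]; split=> // x' Xx' x'x; apply: le_trans y0.
  by have [_ _] := Efib _ 0%N Xx; apply.
have elt k : elt_at Y (oadd (omul omega alpha) (ofin k)) (E x k).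
  split; first by case: (Efib _ k Xx).
  have -> : [set y | Y y /\ y < E x k] =
      [set y | [set y | Y y /\ y < E x 0] y \/ exists2 i, (i < k)%N & E x i = y].
    apply/seteqP; split=> y /=.
      move=> [Yy yk]; have [y0|y0] := ltP y (E x 0); [by left|right].
      have : fiber X Y x y.
        rewrite fibE; split=> //=; rewrite in_itv /= y0.
        by have [_ + _] := Efib _ k Xx; exact: lt_trans.
      move=> /Esurj[//|i ei]; exists i => //; rewrite ltnNge; apply/negP.
      rewrite leq_eqVlt => /orP[/eqP ki|/(Elt _ _ _ Xx)].
        by rewrite -ei ki ltxx in yk.
      by rewrite ei => /(lt_trans yk); rewrite ltxx.
    move=> [[Yy y0]|[i ik <-]]; first by split=> //; exact: lt_le_trans (E0le k).
    by split; [case: (Efib _ i Xx)|exact: Elt].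
  apply: order_type_addn => //; first by move=> i j; exact: Elt.
  by move=> y i [_ /lt_le_trans]; apply.
exists (E x); split=> //; first by split=> //; case: (Efib _ 0%N Xx).
apply/seteqP; split=> y /=.
  by move=> [k /(elt_at_unique (elt k)) <-]; exact: Efib.
by move=> /Esurj[//|k <-]; exists k.
Qed.

End FiberBlock.

End OrderTypes.

(** * Self-similarity *)

Section StableDefects.
Variable R : realType.

(** A set [P] of residues treats the classes and the full set at once. Indexing by numbers not
    divisible by 3 gives each element a single representative, by [st_defect_eqD]. *)
Definition st_defects (P : set 'Z_3) : set R :=
  [set st_defect R m | m in [set m | ~~ (3 %| m)%N /\ P (st_complexity m)%:R]].

Lemma st_complexity_Z3 k m : (0 < m)%N ->
  (st_complexity (3 ^ k * m))%:R = (st_complexity m)%:R :> 'Z_3.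
Proof.
by move=> m0; rewrite st_complexity_mul3 // (natrD _ (3 * k)%N) natr3_Z3 add0r.
Qed.

Lemma st_defects_mem P m : (0 < m)%N -> P (st_complexity m)%:R ->
  st_defects P (st_defect R m).
Proof.
move=> m0; have [v [m' [e m'3]]] := exp3_split m0; have m'0 := ndvd3_gt0 m'3.
by rewrite e st_complexity_Z3 // => Pm; exists m' => //; rewrite st_defectM3.
Qed.

Lemma st_defects_stable P : st_defects P = [set defect R n | n in
  [set n | [/\ (1 < n)%N, stable n & P (complexity n)%:R]]].
Proof.
apply/seteqP; split=> [_ [n [n3 Pn] <-]|_ [n [n1 sn Pn] <-]].
  have n0 := ndvd3_gt0 n3; have sn := stable_exponentP n0.
  exists (3 ^ stable_exponent n * n)%N => //=; split=> //.
    have : (0 < 3 ^ stable_exponent n * n)%N by rewrite muln_gt0 expn_gt0.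
    case: (_ * _)%N sn => [//|[|//]] s1; by have := not_stable1 s1.
  by rewrite complexity_st_exponent // (natrD _ (3 * _)%N) natr3_Z3 add0r.
have n0 := ltnW n1.
rewrite defectE stable_complexity // -st_defectE //; apply: st_defects_mem => //.
by rewrite -stable_complexity.
Qed.

Lemma Dst_classE u : Dst_class R u = st_defects [set u].
Proof. by rewrite st_defects_stable. Qed.

Lemma DstE : Dst R = st_defects setT.
Proof.
rewrite st_defects_stable.
apply/seteqP; split=> [_ [n [n0 sn] <-]|_ [n [n1 sn _] <-]].
  exists n => //; split=> //.
  by case: n n0 sn => [//|[|//]] _ /not_stable1.
by exists n => //; split=> //; exact: ltnW.
Qed.

Lemma limit_st_defects P (C : R) (y : nat -> R) : (forall i, st_defects P (y i)) ->
  (forall i, y i <= C) -> (forall v, \forall i \near \oo, y i <> v) ->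
  exists c j, [/\ ~~ (3 %| c)%N, P ((st_complexity c)%:R + j.+1%:R) &
    forall e : R, 0 < e -> forall i0, exists2 i, (i0 <= i)%N &
      st_defect R c + j.+1%:R - e < y i < st_defect R c + j.+1%:R /\
      (j = 0%N -> factor_defects R c (y i))].
Proof.
move=> yP yC yv.
have /choice[m mP] i : exists m,
    (~~ (3 %| m)%N /\ P (st_complexity m)%:R) /\ st_defect R m = y i.
  by have [m] := yP i; exists m.
have m3 i : ~~ (3 %| m i)%N by case: (mP i) => -[].
have my i : st_defect R (m i) = y i by case: (mP i) => -[].
have [i|v|c [j [c3 j0 h]]] := @limit_defect R C m m3.
- by rewrite my.
- by apply: filterS (yv (st_defect R v)) => i yi mi; apply: yi; rewrite -my mi.
case: j j0 h => // j _ h; exists c, j; split=> //.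
  have [i _ [_ <- _]] := h 1 ltr01 0%N.
  by case: (mP i) => -[].
move=> e e0 i0; have [i i0i [hi _ hj]] := h e e0 i0.
exists i => //; rewrite -my; split=> // j0.
rewrite j0 in hj; have [//|k [a [b [ab ab' e']]]] := hj.
by exists k, a, b; split.
Qed.

(** A strictly decreasing sequence would have a limit point approached from below. *)
Lemma st_defects_wo P : well_ordered (st_defects P).
Proof.
move=> S SP [s0 Ss0]; apply: contrapT => nmin.
have /choice[f fP] s : exists s', S s -> S s' /\ s' < s.
  have [Ss|] := pselect (S s); last by exists 0.
  apply: contrapT => h; apply: nmin; exists s => // y Sy; rewrite leNgt.
  by apply/negP => ys; apply: h; exists y.
pose y i := iter i f s0.
have Sy i : S (y i) by elim: i => //= i /fP[].
have y_lt i j : (i < j)%N -> y j < y i.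
  elim: j => // j IH; rewrite ltnS leq_eqVlt => /orP[/eqP ->|/IH].
    by case: (fP _ (Sy j)).
  by apply: lt_trans; case: (fP _ (Sy j)).
have y_inj : injective y.
  by move=> i j eij; case: (ltngtP i j) => // /y_lt; rewrite eij ltxx.
have [i|i||c [j [_ _ h]]] := @limit_st_defects P s0 y.
- exact: SP.
- by case: i => // i; apply/ltW/(y_lt 0%N).
- exact: injective_near.
have [i _ [/andP[_ hi] _]] := h 1 ltr01 0%N.
(* Taking for [e] the distance from [y i] to the limit yields a later term above [y i]. *)
have [|i' ii' [/andP[hi' _] _]] := h (st_defect R c + j.+1%:R - y i) _ i.
  by rewrite subr_gt0.
rewrite subKr in hi'; move: ii'; rewrite leq_eqVlt => /orP[/eqP e|/y_lt].
  by rewrite e ltxx in hi'.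
by move=> /(lt_trans hi'); rewrite ltxx.
Qed.

(** For large [k] the stable complexity is the naive one, and the ratio of a b 3^k + b to a b 3^k
    tends to 1 from above. *)
Lemma near_mul_exp3_add1 a b (e : R) : (0 < a)%N -> (0 < b)%N -> 0 < e ->
  st_complexity (a * b) = (st_complexity a + st_complexity b)%N ->
  \forall k \near \oo,
    (st_complexity (b * (a * 3 ^ k + 1)))%:R = (st_complexity (a * b))%:R + 1 :> 'Z_3 /\
    st_defect R (a * b) + 1 - e < st_defect R (b * (a * 3 ^ k + 1)) <
    st_defect R (a * b) + 1.
Proof.
move=> a0 b0 e0 ab; have [M hM] := lg3_close e0.
near=> k.
have Mk : (M <= k)%N by near: k; exact: nbhs_infty_ge.
have ck : st_complexity (b * (a * 3 ^ k + 1)) =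
    (st_complexity a + st_complexity b + 1 + 3 * k)%N.
  by near: k; exact: complexity_eventually.
rewrite ck -ab; split; first by rewrite natrD natr3_Z3 addr0 natrD.
have ab0 : (0 < a * b)%N by rewrite muln_gt0 a0.
have x0 : (0 < 3 ^ k * (a * b))%N by rewrite muln_gt0 expn_gt0.
have xy : (3 ^ k * (a * b) < b * (a * 3 ^ k + 1))%N by lia.
(* The two numbers differ by [b], so this amounts to the ratio condition of [hM]. *)
have M3 : (M * b <= 3 ^ k * (a * b))%N.
  have : (M <= 3 ^ k)%N := leq_trans Mk (ltnW (ltn_expl k (isT : 1 < 3)%N)).
  by move: (3 ^ k)%N => p Mp; apply: leq_mul => //; rewrite leq_pmull.
have := hM (3 ^ k * (a * b))%N (b * (a * 3 ^ k + 1))%N.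
rewrite x0 (ltnW xy) => /(_ isT) h.
have {h} := h ltac:(lia).
have : lg3 R (3 ^ k * (a * b)) < lg3 R (b * (a * 3 ^ k + 1)).
  by rewrite ltr_lg3 //; apply: leq_ltn_trans xy.
rewrite lg3_exp3 // !st_defectE ?(leq_ltn_trans _ xy) // ck -ab.
have -> : (st_complexity (a * b) + 1 + 3 * k)%:R =
    (st_complexity (a * b))%:R + 1 + (3 * k)%:R :> R.
  by rewrite (natrD _ (_ + 1)%N) natrD.
by move=> l1 l2; apply/andP; split; lra.
Unshelve. all: by end_near.
Qed.

(** Each passage from [m] to [m * 3 ^ k + 1] with large [k] adds 1 to the residue and nearly 1 to
    the defect; half of [e] is kept for the last passage. *)
Lemma st_defect_approx c j (e : R) : ~~ (3 %| c)%N -> 0 < e -> exists m,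
  [/\ (0 < m)%N, (st_complexity m)%:R = (st_complexity c)%:R + j%:R :> 'Z_3 &
  st_defect R c + j%:R - e < st_defect R m <= st_defect R c + j%:R].
Proof.
move=> c3; have c0 := ndvd3_gt0 c3; elim: j e => [|j IH] e e0.
  by exists c; rewrite !addr0 lexx ltrBlDr ltrDl e0.
have [|m [m0 mj /andP[m1 m2]]] := IH (e / 2); first by rewrite divr_gt0.
have [||k [hk /andP[k1 k2]]] := filter_ex (@near_mul_exp3_add1 m 1 (e / 2) m0 isT _ _).
- by rewrite divr_gt0.
- by rewrite muln1 st_complexity1 addn0.
exists (1 * (m * 3 ^ k + 1))%N; rewrite muln1 in hk k1 k2; split.
- by rewrite mul1n addn1.
- by rewrite hk mj -natr1 addrA.
- by rewrite -natr1; apply/andP; split; lra.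
Qed.

(** Accumulation from below at [st_defect R n] would make it some [st_defect R c] plus a positive
    integer, which [st_defect_eqD] excludes. *)
Lemma st_defect_isolated P n : ~~ (3 %| n)%N ->
  exists2 e : R, 0 < e & forall x, st_defects P x -> x < st_defect R n ->
    x <= st_defect R n - e.
Proof.
move=> n3; apply: contrapT => h; set x := st_defect R n.
have /choice[y yP] i : exists y, [/\ st_defects P y, y < x & x - i.+1%:R^-1 < y].
  apply: contrapT => hi; apply: h; exists i.+1%:R^-1; first by rewrite invr_gt0.
  move=> z Pz zx; rewrite leNgt; apply/negP => xz; apply: hi; by exists z.
have yx i : y i < x by case: (yP i).
have ynear z : z < x -> \forall i \near \oo, z < y i.
  rewrite -subr_gt0 => zx; have [K hK] := nat_upper_bound (x - z)^-1.
  exists K => // i /= Ki; have [_ _] := yP i; apply: le_lt_trans.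
  rewrite lerBrDr -lerBrDl -[leRHS]invrK lef_pV2 ?posrE ?invr_gt0 //.
  by apply: (le_trans hK); rewrite ler_nat ltnW.
have [i|i|v|c [j [c3 _ lim]]] := @limit_st_defects P x y.
- by case: (yP i).
- exact: ltW.
- have [vx|xv] := ltP v x.
    by apply: filterS (ynear v vx) => i + e; rewrite e ltxx.
  by apply: filterE => i e; have := yx i; rewrite e ltNge xv.
have px : st_defect R c + j.+1%:R = x.
  have [px|xp|//] := ltgtP (st_defect R c + j.+1%:R) x.
    have [K _ hK] := ynear _ px.
    have [i Ki [/andP[_ hi] _]] := lim 1 ltr01 K.
    by have := lt_trans hi (hK i Ki); rewrite ltxx.
  have [|i _ [/andP[hi _] _]] := lim (st_defect R c + j.+1%:R - x) _ 0%N.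
    by rewrite subr_gt0.
  by rewrite subKr in hi; have := lt_trans hi (yx i); rewrite ltxx.
by have [] := @st_defect_eqD R c n j.+1 0 c3 n3; rewrite ?addr0.
Qed.

(** * Shift of the residue class by one *)

Section Shift.
(** The sets [[set u]] and [[set u + 1]] give the statement for classes, and [setT] taken twice
    gives the one for [Dst]. *)
Variables P Q : set 'Z_3.
Hypothesis PQ : forall z, Q (z + 1) <-> P z.

Let X := st_defects P.
Let Y := st_defects Q.

(* A limit point c + j below x + 1 would leave room for elements x' of X
   with x' + 1 close to c + j, contradicting membership in the fiber. *)
Lemma fiber_limit x (y : nat -> R) : (forall i, fiber X Y x (y i)) ->
  (forall v, \forall i \near \oo, y i <> v) ->
  exists c j, [/\ ~~ (3 %| c)%N, st_defect R c + j.+1%:R = x + 1 &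
    forall e : R, 0 < e -> forall i0, exists2 i, (i0 <= i)%N &
      x + 1 - e < y i /\ (j = 0%N -> factor_defects R c (y i))].
Proof.
move=> yF yv.
have [i|i|//|c [j [c3 Qc lim]]] := @limit_st_defects Q (x + 1) y.
- by case: (yF i).
- by apply: ltW; case: (yF i).
suff px : st_defect R c + j.+1%:R = x + 1.
  exists c, j; split=> // e e0 i0; have [i i0i [/andP[hi _] hj]] := lim e e0 i0.
  by exists i => //; rewrite -px.
have [px|xp|//] := ltgtP (st_defect R c + j.+1%:R) (x + 1); last first.
  have [|i _ [/andP[hi _] _]] := lim (st_defect R c + j.+1%:R - (x + 1)) _ 0%N.
    by rewrite subr_gt0.
  by rewrite subKr in hi; have [_ /(lt_trans hi)] := yF i; rewrite ltxx.
have [i _ [/andP[_ hi] _]] := lim 1 ltr01 0%N.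
have [|m [m0 mj /andP[m1 m2]]] := @st_defect_approx c j (st_defect R c + j.+1%:R - y i) c3.
  by rewrite subr_gt0.
have [_ _ /(_ (st_defect R m))] := yF i.
have Xm : X (st_defect R m).
  by apply: st_defects_mem => //; rewrite mj; apply/PQ; rewrite -addrA natr1.
move: px hi m1 m2; rewrite -[j.+1%:R]natr1 => px hi m1 m2 /(_ Xm).
have mx : st_defect R m < x by lra.
by move=> /(_ mx); lra.
Qed.

(** Infinitely many elements up to [z] would accumulate at [x + 1], by [fiber_limit]. *)
Lemma fiber_finite x z : X x -> z < x + 1 -> finite_set [set y | fiber X Y x y /\ y <= z].
Proof.
move=> _ zx; apply: contrapT => nF; have [y y_inj yF] := infinite_seq nF.
have [i|c [j [_ _ lim]]] := @fiber_limit x y _ (injective_near y_inj).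
  by case: (yF i).
have [|i _ [hi _]] := lim (x + 1 - z) _ 0%N; first by rewrite subr_gt0.
by rewrite subKr in hi; have [_] := yF i; rewrite leNgt hi.
Qed.

(** The values tend to [st_defect R n + 1] from below, while isolation of [st_defect R n] keeps
    every smaller [x' + 1] at distance at least [e] below that limit. *)
Lemma near_fiber n a b : ~~ (3 %| n)%N -> P (st_complexity n)%:R -> (a * b)%N = n ->
  st_complexity n = (st_complexity a + st_complexity b)%N ->
  \forall k \near \oo, fiber X Y (st_defect R n) (st_defect R (b * (a * 3 ^ k + 1))).
Proof.
move=> n3 Pn ab hab; have n0 := ndvd3_gt0 n3.
have [a0 b0] : (0 < a)%N /\ (0 < b)%N by apply/andP; rewrite -muln_gt0 ab.
have [e e0 he] := st_defect_isolated P n3.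
rewrite -ab in hab; apply: filterS (near_mul_exp3_add1 a0 b0 e0 hab) => k.
rewrite ab => -[hk /andP[k1 k2]]; split=> //.
  apply: st_defects_mem; first by rewrite muln_gt0 b0 addn1.
  by rewrite hk; apply/PQ.
by move=> x' Xx' x'n; have := he x' Xx' x'n; lra.
Qed.

Lemma fiber_infinite x : X x -> infinite_set (fiber X Y x).
Proof.
move=> [n [n3 Pn] <-] /=.
have n0 := ndvd3_gt0 n3.
have [|K _ hK] := @near_fiber n n 1 n3 Pn (muln1 n); first by rewrite st_complexity1 addn0.
(* The factorization is the trivial one with [b = 1]. A positive exponent keeps the numbers prime to
   3, so distinct numbers have distinct stable defects. *)
pose y i := st_defect R (1 * (n * 3 ^ (K + i).+1 + 1)).
suff y_inj : injective y.
  move=> F; apply: infinite_nat; rewrite -(eq_finite_set (inj_card_eq (in2W y_inj))).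
  by apply: sub_finite_set F => _ [i _ <-]; apply: hK => /=; lia.
have nd i : ~~ (3 %| 1 * (n * 3 ^ (K + i).+1 + 1))%N.
  by rewrite mul1n dvdn_addr // expnS mulnCA dvdn_mulr.
move=> i j eij; have [|+ _] := @st_defect_eqD R _ _ 0 0 (nd i) (nd j).
  by rewrite !addr0.
rewrite !mul1n => /eqP; rewrite eqn_add2r eqn_pmul2l // eqn_exp2l // => /eqP; lia.
Qed.

(** If infinitely many fiber elements were not factor defects, they would accumulate at
    [st_defect R n + 1]; [st_defect_eqD] then gives [c = n] and [j = 0], so one of them is a factor
    defect. Conversely, the finitely many factorizations of [n] share a threshold on [k] beyond
    which the values lie in the fiber. *)
Lemma fiber_factor n : ~~ (3 %| n)%N -> P (st_complexity n)%:R ->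
  finite_set (fiber X Y (st_defect R n) `+` factor_defects R n).
Proof.
move=> n3 Pn; have n0 := ndvd3_gt0 n3; rewrite /setY finite_setU; split.
  apply: contrapT => nF; have [y y_inj yF] := infinite_seq nF.
  have [i|c [j [c3 px lim]]] := @fiber_limit (st_defect R n) y _ (injective_near y_inj).
    by case: (yF i).
  have [cn [j0]] := @st_defect_eqD R c n j.+1 1 c3 n3 px.
  have [i _ [_]] := lim 1 ltr01 0%N; rewrite cn j0 => /(_ erefl).
  by case: (yF i).
have : \forall k \near \oo, forall q : 'I_n.+1 * 'I_n.+1, (q.1 * q.2)%N = n ->
    st_complexity n = (st_complexity q.1 + st_complexity q.2)%N ->
    fiber X Y (st_defect R n) (st_defect R (q.2 * (q.1 * 3 ^ k + 1))).
  apply: filter_forall => q.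
  have [e|ne] := pselect ((q.1 * q.2)%N = n /\
      st_complexity n = (st_complexity q.1 + st_complexity q.2)%N).
    by apply: filterS (near_fiber n3 Pn e.1 e.2).
  by apply: filterE => k e1 e2; case: ne.
move=> [K _ hK].
apply: sub_finite_set (finite_image (fun q : 'I_K * ('I_n.+1 * 'I_n.+1) =>
  st_defect R (q.2.2 * (q.2.1 * 3 ^ q.1 + 1))) (@finite_finset _ setT)).
move=> _ [[k [a [b [ab hab ->]]]] nF].
have [a0 b0] : (0 < a)%N /\ (0 < b)%N by apply/andP; rewrite -muln_gt0 ab.
have an : (a < n.+1)%N by rewrite ltnS -ab leq_pmulr.
have bn : (b < n.+1)%N by rewrite ltnS -ab leq_pmull.
have [Kk|kK] := leqP K k.
  by case: nF; exact: (hK k Kk (Ordinal an, Ordinal bn)).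
by exists (Ordinal kK, (Ordinal an, Ordinal bn)).
Qed.

Lemma st_defects_block n : ~~ (3 %| n)%N -> P (st_complexity n)%:R ->
  (exists alpha, elt_at X alpha (st_defect R n)) /\
  forall alpha : ordinal_number, elt_at X alpha (st_defect R n) ->
    [/\ forall k, exists x, elt_at Y (oadd (omul omega alpha) (ofin k)) x,
        exists2 l, elt_at Y (omul omega alpha) l &
          block Y alpha = Y `&` `[l, st_defect R n + 1[
      & finite_set (block Y alpha `+` factor_defects R n)].
Proof.
move=> n3 Pn; have n0 := ndvd3_gt0 n3; split.
  by apply: elt_at_exists; [exact: st_defects_wo|exact: st_defects_mem].
move=> alpha hn.
have [e [ek e0 -> fibE]] := fiber_block (@st_defects_wo P) (@st_defects_wo Q)
  fiber_infinite fiber_finite hn.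
split; [by move=> k; exists (e k)|by exists (e 0%N)|exact: fiber_factor].
Qed.

End Shift.
End StableDefects.

Theorem theorem4p19 (R : realType) (n : nat) (hn : ~~ (3 %| n)%N) (u : 'Z_3)
    (hu : u = (st_complexity n)%:R) :
  ((exists alpha, elt_at (Dst_class R u) alpha (st_defect R n)) /\
   forall alpha : ordinal_number,
     elt_at (Dst_class R u) alpha (st_defect R n) ->
     [/\ forall k, exists x,
           elt_at (Dst_class R (u + 1)) (oadd (omul omega alpha) (ofin k)) x,
         exists2 l, elt_at (Dst_class R (u + 1)) (omul omega alpha) l &
           block (Dst_class R (u + 1)) alpha =
           Dst_class R (u + 1) `&` `[l, st_defect R n + 1[
       & finite_set (block (Dst_class R (u + 1)) alpha `+` factor_defects R n)])
  /\
  ((exists alpha, elt_at (Dst R) alpha (st_defect R n)) /\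
   forall alpha : ordinal_number,
     elt_at (Dst R) alpha (st_defect R n) ->
     [/\ forall k, exists x,
           elt_at (Dst R) (oadd (omul omega alpha) (ofin k)) x,
         exists2 l, elt_at (Dst R) (omul omega alpha) l &
           block (Dst R) alpha = Dst R `&` `[l, st_defect R n + 1[
       & finite_set (block (Dst R) alpha `+` factor_defects R n)]).
Proof.
rewrite !Dst_classE DstE; split; last exact: st_defects_block.
apply: st_defects_block => //.
by move=> z; split=> [/addIr //|->].
Qed.
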